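(* Let $X$ and $U$ be Hilbert spaces, let $A$ be the infinitesimal generator of a strongly continuous semigroup $T(t)$ on $X$, let $B:U\to X$ be a bounded linear operator, and let $f:X\to X$ be continuously Fréchet differentiable with $f(0)=0$ and $Df(0)=0$. Let $\tau>0$ and let $\mathcal{U}\subset L_2([0,\tau];U)$ be an open neighborhood of $u=0$ such that for every $u\in\mathcal{U}$ the semilinear system $\dot x(t)=Ax(t)+f(x(t))+Bu(t)$, $x(0)=0$, has a unique mild solution on $[0,\tau]$, denoted by $x(t)=S_t(u)$, $t\in[0,\tau]$. Assume that $f$ meets the following conditions: (B1) For every bounded set $\mathcal{B}\subset X$ there exist positive constants $\alpha,\gamma\in\mathbb{R}$ such that $\|f(x_1)-f(x_2)-Df(x_2)(x_1-x_2)\|_X\le\alpha\|x_1-x_2\|_X^{1+\gamma}$ for all $x_1,x_2\in\mathcal{B}$. (B2) The Fréchet derivative $Df$ is locally Lipschitz continuous. If the linearized system $\Delta\dot x(t)=A\Delta x(t)+B\Delta u(t)$ is exactly controllable on $[0,\tau]$, then the semilinear system $\dot x(t)=Ax(t)+f(x(t))+Bu(t)$ is locally exactly controllable on $[0,\tau]$.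
   Context: Mild solution: for $u\in L_2([0,\tau];U)$, a mild solution on $[0,\tau]$ of $\dot x(t)=Ax(t)+f(x(t))+Bu(t)$, $x(0)=0$, is a continuous function $x:[0,\tau]\to X$ satisfying $$x(t)=\int_0^t T(t-s)\bigl(f(x(s))+Bu(s)\bigr)\,ds\quad\text{for all }t\in[0,\tau].$$ A map is continuously Fréchet differentiable if it is Fréchet differentiable at every point and the derivative depends continuously (in the operator norm) on the point. Local Lipschitz continuity of $Df$ is meant with respect to the operator norm on bounded linear operators $X\to X$. Exact controllability of the linearized system $\Delta\dot x=A\Delta x+B\Delta u$ on $[0,\tau]$ means that its controllability map $L_2([0,\tau];U)\to X$, $\Delta u\mapsto\int_0^\tau T(\tau-s)B\Delta u(s)\,ds$, is surjective. Local exact controllability of the semilinear system on $[0,\tau]$ means that the controllability map $S_\tau:\mathcal{U}\to X$ is locally surjective, i.e. there is an open neighborhood $W$ of the origin in $X$ such that for every $x_\tau\in W$ there is an input trajectory $u\in\mathcal{U}$ with $x_\tau=S_\tau(u)$. *)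

(* Defs.v *)
(* MathComp / MathComp-Analysis. *)
From HB Require Import structures.
From mathcomp Require Import all_boot all_order all_algebra.
From mathcomp Require Import sesquilinear complex.
From mathcomp Require Import all_classical all_reals all_analysis.
Set Implicit Arguments.
Unset Strict Implicit.
Unset Printing Implicit Defensive.
Import Order.TTheory GRing.Theory Num.Theory.
Import numFieldNormedType.Exports.
Local Open Scope classical_set_scope.
Local Open Scope ring_scope.

(* The scalar field K of the Hilbert spaces is either R or C = R[i]; time and
   all estimates are in R. *)
Variant scalar_field (R : realType) : numFieldType -> Type :=
| RealScalars : scalar_field R R
| ComplexScalars : scalar_field R R[i].

Definition scalar_re (R : realType) (K : numFieldType) (k : scalar_field R K) :
    K -> R :=
  match k in scalar_field _ K' return K' -> R with
  | RealScalars => fun z => z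
  | ComplexScalars => fun z => complex.Re z
  end.

Definition of_real (R : realType) (K : numFieldType) (k : scalar_field R K) :
    R -> K :=
  match k in scalar_field _ K' return R -> K' with
  | RealScalars => fun r => r
  | ComplexScalars => fun r => (r%:C)%C
  end.

Definition scalar_conj (R : realType) (K : numFieldType)
    (k : scalar_field R K) : K -> K :=
  match k in scalar_field _ K' return K' -> K' with
  | RealScalars => fun z => z
  | ComplexScalars => fun z => (z^*)%C
  end.

(* The norm `|x| of a normedModType K is K-valued; [norm k x] is the same
   number seen in R. *)
Definition norm (R : realType) (K : numFieldType) (k : scalar_field R K)
    (V : normedModType K) (x : V) : R := scalar_re k `|x|.

(* To be used with V complete (completeNormedModType). *)
Definition hilbert_norm (R : realType) (K : numFieldType)
    (k : scalar_field R K) (V : normedModType K) : Prop :=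
  exists dot : {dot V for scalar_conj k}, forall x : V, `|x| ^+ 2 = dot x x.

Definition opnorm (R : realType) (K : numFieldType) (k : scalar_field R K)
    (V W : normedModType K) (L : V -> W) : R :=
  sup [set norm k (L h) | h in [set h : V | norm k h <= 1]].

Section bochner.
Context (R : realType) (K : numFieldType) (k : scalar_field R K).
Context (V : normedModType K).
Let mu := @lebesgue_measure R.

Definition simple_function (s : R -> V) : Prop :=
  finite_set (range s) /\
  forall y : V, measurable (s @^-1` [set y] : set (measurableTypeR R)).

(* Pointwise limits of Borel simple functions: every almost-everywhere class of
   Lebesgue-Bochner measurable functions on [0, t] has such a representative. *)
Definition strongly_measurable (t : R) (g : R -> V) : Prop :=
  exists s : nat -> R -> V,
    (forall n, simple_function (s n)) /\
    (forall r, 0 <= r <= t -> s n r @[n --> \oo] --> g r).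

Definition simple_integral (t : R) (s : R -> V) : V :=
  \sum_(y \in range s)
    of_real k (fine (mu (`[0, t] `&` s @^-1` [set y]))) *: y.

(* g is Bochner integrable on [0, t], with integral v. *)
Definition has_bochner_integral (t : R) (g : R -> V) (v : V) : Prop :=
  strongly_measurable t g /\
  exists s : nat -> R -> V,
    [/\ forall n, simple_function (s n),
        (\int[mu]_(r in `[0%R, t]) (norm k (g r - s n r))%:E)%E
           @[n --> \oo] --> 0%E
      & simple_integral t (s n) @[n --> \oo] --> v].

(* L2([0, t]; V) is handled through representatives R -> V, with its seminorm;
   values outside [0, t] are irrelevant. *)
Definition L2 (t : R) : set (R -> V) :=
  [set u | strongly_measurable t u /\
     (\int[mu]_(r in `[0%R, t]) (norm k (u r) ^+ 2)%:E < +oo)%E].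

Definition L2norm (t : R) (u : R -> V) : R :=
  Num.sqrt (fine (\int[mu]_(r in `[0%R, t]) (norm k (u r) ^+ 2)%:E)%E).

(* Open subsets of L2([0, t]; V). Such a set of representatives is closed under
   almost-everywhere equality within L2, so it is an open set of classes. *)
Definition L2_open (t : R) (O : set (R -> V)) : Prop :=
  O `<=` L2 t /\
  forall u, O u -> exists2 e : R, 0 < e &
    forall v, L2 t v -> L2norm t (v \- u) < e -> O v.

End bochner.

Section systems.
Context (R : realType) (K : numFieldType) (k : scalar_field R K).
Context (X U : normedModType K).

(* Only the operators T t with t >= 0 matter. *)
Definition strongly_continuous_semigroup (T : R -> {linear X -> X}) : Prop :=
  [/\ forall t, 0 <= t -> continuous (T t),
      forall x, T 0 x = x,
      forall s t x, 0 <= s -> 0 <= t -> T (s + t) x = T s (T t x)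
    & forall x, T t x @[t --> 0^'+] --> x].

(* The unbounded operator A has domain domA; outside domA the values of the
   Rocq function A are junk. *)
Definition infinitesimal_generator (T : R -> {linear X -> X})
    (domA : set X) (A : X -> X) : Prop :=
  forall x y : X,
    of_real k h^-1 *: (T h x - x) @[h --> 0^'+] --> y <->
    domA x /\ A x = y.

Definition continuously_differentiable (f : X -> X) : Prop :=
  (forall x, differentiable f x) /\
  forall x (e : R), 0 < e -> exists2 d : R, 0 < d &
    forall y, norm k (y - x) < d -> opnorm k ('d f y \- 'd f x) < e.

Definition derivative_locally_lipschitz (f : X -> X) : Prop :=
  forall x, exists d L : R, 0 < d /\
    forall y z, norm k (y - x) < d -> norm k (z - x) < d ->
      opnorm k ('d f y \- 'd f z) <= L * norm k (y - z).

Definition uniform_taylor_bound (f : X -> X) : Prop :=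
  forall S : set X, bounded_set S -> exists alpha gamma : R,
    [/\ 0 < alpha, 0 < gamma &
        forall x1 x2, S x1 -> S x2 ->
          norm k (f x1 - f x2 - 'd f x2 (x1 - x2))
            <= alpha * norm k (x1 - x2) `^ (1 + gamma)].

Definition mild_solution (T : R -> {linear X -> X}) (f : X -> X)
    (B : {linear U -> X}) (tau : R) (u : R -> U) (x : R -> X) : Prop :=
  {within `[0, tau], continuous x} /\
  forall t, 0 <= t <= tau ->
    has_bochner_integral k t (fun s => T (t - s) (f (x s) + B (u s))) (x t).

(* Surjectivity of u |-> \int_0^tau T(tau - s) B u(s) ds on L2([0, tau]; U). *)
Definition exactly_controllable (T : R -> {linear X -> X})
    (B : {linear U -> X}) (tau : R) : Prop :=
  forall z : X, exists2 u : R -> U, L2 k tau u &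
    has_bochner_integral k tau (fun s => T (tau - s) (B (u s))) z.

(* Local surjectivity at the origin of the controllability map
   S tau : Uad -> X. *)
Definition locally_exactly_controllable (Uad : set (R -> U))
    (S : R -> (R -> U) -> X) (tau : R) : Prop :=
  exists W : set X, [/\ open W, W 0 &
    forall z, W z -> exists2 u, Uad u & z = S tau u].

End systems.

(* Main.v *)
(* Graves' iteration.  By Baire's theorem, exact controllability of the
   linearized system provides, for every residual r, a control v with
   |v| <= C |r| whose linear response misses r by at most |r| / 4.  Since
   Df(0) = 0, the map f is Lipschitz near 0 with a constant as small as we
   please, so small controls have small trajectories that depend Lipschitz
   continuously on the control, and the change of S tau under u -> u + v is the
   linear response to v up to another |r| / 4.  Correcting u by v therefore
   halves the residual z - S tau u.  For small z the corrections have a small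
   sum in L2, and their limit is the control sought. *)
Require Import Defs.
From HB Require Import structures.
From mathcomp Require Import all_boot all_order all_algebra.
From mathcomp Require Import complex finmap.
From mathcomp Require Import all_classical all_reals all_analysis.
From mathcomp Require Import measurable_realfun ring lra.
Set Implicit Arguments.
Unset Strict Implicit.
Unset Printing Implicit Defensive.
Import Order.TTheory GRing.Theory Num.Theory.
Import numFieldNormedType.Exports.
Local Open Scope classical_set_scope.
Local Open Scope ring_scope.

(** * The real-valued norm *)

(** The scheme needs neither a derivative of [S tau] nor a linear right inverse of the linear
    response. If x and y are the trajectories of u and u - v, then S tau (u - v) - S tau u plus the
    linear response to v is the integral of T (tau - s) (f (y s) - f (x s)). The small Lipschitz
    constant of f bounds this uniformly in u, so every step uses the same linear system, the one at
    the origin. Two obstacles shape the estimates. The Lipschitz bound holds only in a ball, which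
    trajectories must be shown not to leave. And L2 consists of functions that are everywhere limits
    of simple ones, so the limit control has to be built as such a function. The constants do not
    depend on each other in a circle: C comes from the linear system alone and is the same for every
    relative error, the Lipschitz constant of f is fixed by C, the radius [rho] by that constant,
    the bound on controls by [rho], and the size of W by all of these. *)

Section scalars.
Context (R : realType) (K : numFieldType) (k : scalar_field R K).

Lemma scalar_reK (z : K) : 0 <= z -> of_real k (scalar_re k z) = z.
Proof.
case: k z => //= -[a b] /=; rewrite lecE /= => /andP[/eqP -> _]; by [].
Qed.

Lemma of_realK (r : R) : scalar_re k (of_real k r) = r.
Proof. by case: k. Qed.

Lemma of_real_le (a b : R) : (of_real k a <= of_real k b) = (a <= b).
Proof. by case: k => //=; rewrite lecR. Qed.

Lemma of_real_lt (a b : R) : (of_real k a < of_real k b) = (a < b).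
Proof. by case: k => //=; rewrite ltcR. Qed.

Lemma of_real0 : of_real k 0 = 0.
Proof. by case: k. Qed.

Lemma of_realM (a b : R) : of_real k (a * b) = of_real k a * of_real k b.
Proof. by case: k => //=; rewrite rmorphM. Qed.

Lemma of_realD (a b : R) : of_real k (a + b) = of_real k a + of_real k b.
Proof. by case: k => //=; rewrite rmorphD. Qed.

Lemma of_real1 : of_real k 1 = 1.
Proof. by case: k. Qed.

Lemma norm_of_real (a : R) : `|of_real k a| = of_real k `|a|.
Proof. by case: k => //=; rewrite normc_def /= expr0n addr0 sqrtr_sqr. Qed.

Context (V : normedModType K).
Implicit Types x y z : V.
Local Notation N := (norm k).

Lemma normr_knorm x : `|x| = of_real k (N x).
Proof. by rewrite scalar_reK. Qed.

Lemma normr_le_of_real x (a : R) : (`|x| <= of_real k a) = (N x <= a).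
Proof. by rewrite normr_knorm of_real_le. Qed.

Lemma normr_lt_of_real x (a : R) : (`|x| < of_real k a) = (N x < a).
Proof. by rewrite normr_knorm of_real_lt. Qed.

Lemma knorm_ge0 x : 0 <= N x.
Proof. by rewrite -of_real_le of_real0 -normr_knorm. Qed.

Lemma knorm0 : N (0 : V) = 0.
Proof. by rewrite /norm normr0 -of_real0 of_realK. Qed.

Lemma knorm0_eq0 x : N x = 0 -> x = 0.
Proof. by move=> h; apply/eqP; rewrite -normr_eq0 normr_knorm h of_real0. Qed.

Lemma knormD_le x y : N (x + y) <= N x + N y.
Proof. by rewrite -normr_le_of_real of_realD -!normr_knorm ler_normD. Qed.

Lemma knormN x : N (- x) = N x.
Proof. by rewrite /norm normrN. Qed.

Lemma knorm_distC x y : N (x - y) = N (y - x).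
Proof. by rewrite /norm distrC. Qed.

Lemma knormB_le x y : N (x - y) <= N x + N y.
Proof. by rewrite (le_trans (knormD_le _ _)) // knormN. Qed.

Lemma knorm_triangle y x z : N (x - z) <= N (x - y) + N (y - z).
Proof. by rewrite (_ : x - z = x - y + (y - z)) ?knormD_le // addrA subrK. Qed.

Lemma knorm_dist_le x y : `|N x - N y| <= N (x - y).
Proof.
rewrite ler_norml; apply/andP; split.
  by rewrite lerNl opprB lerBlDr knorm_distC (le_trans _ (knormD_le _ _)) // subrK.
by rewrite lerBlDr (le_trans _ (knormD_le _ _)) // subrK.
Qed.

Lemma knormZ (a : K) x : N (a *: x) = scalar_re k `|a| * N x.
Proof.
rewrite /norm normrZ -[in LHS](scalar_reK (normr_ge0 a)) [in LHS]normr_knorm.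
by rewrite -of_realM of_realK.
Qed.

Lemma knormZ_real (a : R) x : N (of_real k a *: x) = `|a| * N x.
Proof. by rewrite knormZ norm_of_real of_realK. Qed.

(** A positive scalar is real even over [R[i]], so balls with real radii already form a basis of
    neighbourhoods. *)
Lemma nbhs_knormP x (P : set V) :
  nbhs x P <-> exists2 e : R, 0 < e & forall y, N (y - x) < e -> P y.
Proof.
split=> [/nbhs_normP[e /= e0 eP]|[e e0 eP]].
  have eE : e = of_real k (scalar_re k e) by rewrite scalar_reK // ltW.
  exists (scalar_re k e) => [|y xy]; first by rewrite -of_real_lt of_real0 -eE.
  by apply: eP => /=; rewrite distrC eE normr_lt_of_real.
apply/nbhs_normP; exists (of_real k e); first by rewrite /= -of_real0 of_real_lt.
by move=> y /=; rewrite distrC normr_lt_of_real; exact: eP.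
Qed.

Lemma cvg_knormP {I : Type} (F : set_system I) {FF : Filter F} (g : I -> V) x :
  g @ F --> x <-> forall e : R, 0 < e -> \forall t \near F, N (g t - x) < e.
Proof.
split=> [gx e e0|gx P /nbhs_knormP[e e0 eP]].
  have : nbhs x [set y | N (y - x) < e] by apply/nbhs_knormP; exists e.
  by move/gx.
by apply: filterS (gx _ e0) => t /eP.
Qed.

Lemma knorm_continuous : continuous (@norm R K k V).
Proof.
move=> x; apply/cvgrPdist_lt => e e0; apply/nbhs_knormP; exists e => // y xy.
by rewrite distrC (le_lt_trans (knorm_dist_le _ _)).
Qed.

Lemma cvg_knorm {I : Type} (F : set_system I) {FF : Filter F} (g : I -> V) x :
  g @ F --> x -> N (g t) @[t --> F] --> N x.
Proof. by move=> gx; apply: continuous_cvg => //; exact: knorm_continuous. Qed.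

End scalars.

(** * Cauchy sequences and Baire's theorem in the real-valued norm *)

Section complete.
Context (R : realType) (K : numFieldType) (k : scalar_field R K).
Context (V : completeNormedModType K).
Implicit Types x y z : V.
Local Notation N := (norm k).

Lemma cauchy_knorm_cvg (a : nat -> V) :
  (forall e : R, 0 < e -> exists n0, forall n m, (n0 <= n)%N -> (n0 <= m)%N ->
     N (a n - a m) < e) ->
  exists l : V, a n @[n --> \oo] --> l.
Proof.
move=> ca; suff : cvg (a @ \oo) by move/cvg_ex.
apply: cauchy_cvg; apply: cauchy_exP => e e0.
have eE : e = of_real k (scalar_re k e) by rewrite scalar_reK // ltW.
have /ca[n0 hn0] : 0 < scalar_re k e by rewrite -(of_real_lt k) of_real0 -eE.
exists (a n0); exists n0 => // m n0m; rewrite /= -ball_normE /ball_ /=.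
by rewrite eE normr_lt_of_real; apply: hn0.
Qed.

Definition knorm_ball x (r : R) := [set y : V | N (y - x) < r].

(* [Baire] of MathComp-Analysis only covers real scalars. *)
Lemma baire_category (F : nat -> set V) : (forall n, closed (F n)) ->
  (forall x, exists n, F n x) ->
  exists n x r, 0 < r /\ knorm_ball x r `<=` F n.
Proof.
move=> Fc Fx; apply: contrapT => nF.
have step : forall q : nat * (V * R), exists q' : V * R, 0 < q.2.2 ->
    [/\ 0 < q'.2, q'.2 <= q.2.2 / 2,
        knorm_ball q'.1 (2 * q'.2) `<=` knorm_ball q.2.1 q.2.2
      & knorm_ball q'.1 (2 * q'.2) `<=` ~` F q.1].
  move=> [n [x r]] /=; have [r0|nr0] := pselect (0 < r); last by exists (x, r).
  have [y [xy nFy]] : exists y, knorm_ball x r y /\ ~ F n y.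
    apply: contrapT => h; apply: nF; exists n, x, r; split=> // y xy.
    by apply: contrapT => nFy; apply: h; exists y.
  have : nbhs y (~` F n) by apply: open_nbhs_nbhs; split=> //; rewrite openC.
  move=> /(nbhs_knormP k)[e e0 eF].
  (* [r / 2] makes the radii geometric; the other two bounds keep the ball of doubled radius outside
     [F n] and inside the old ball. Doubling is needed because a limit of points of an open ball may
     lie on its boundary. *)
  pose s := Num.min (r / 2) (Num.min (e / 2) ((r - N (y - x)) / 2)).
  have [s1 s2 s3] : [/\ s <= r / 2, s <= e / 2 & s <= (r - N (y - x)) / 2].
    by rewrite /s !ge_min !lexx ?orbT.
  exists (y, s) => _; split => //=.
  - rewrite /s !lt_min; move: xy; rewrite /knorm_ball /= => xy.
    by rewrite !divr_gt0 // subr_gt0.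
  - move=> w; rewrite /knorm_ball /= => wy.
    by rewrite (le_lt_trans (knorm_triangle k y _ _)) //; lra.
  - move=> w; rewrite /knorm_ball /= => wy; apply: eF; lra.
have [g gP] := choice step.
pose fix q n := if n is p.+1 then g (p, q p) else (0 : V, 1 : R).
have q0 n : 0 < (q n).2 by elim: n => [|n ih] //=; case: (gP (n, q n) ih).
have qr n : (q n).2 <= (1 / 2) ^+ n.
  elim: n => [|n ih] /=; first by rewrite expr0.
  case: (gP (n, q n) (q0 n)) => /= _ h _ _; rewrite exprSr; apply: (le_trans h).
  by rewrite mulrA mulr1 ler_pM2r.
have qS n : knorm_ball (q n.+1).1 (2 * (q n.+1).2) `<=` knorm_ball (q n).1 (q n).2.
  by case: (gP (n, q n) (q0 n)).
have qsub n m : (n <= m)%N ->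
    knorm_ball (q m).1 (q m).2 `<=` knorm_ball (q n).1 (q n).2.
  elim: m => [|m ih]; first by rewrite leqn0 => /eqP ->.
  rewrite leq_eqVlt => /orP[/eqP -> //|/ih h] y hy; apply: h; apply: qS.
  move: hy; rewrite /knorm_ball /= => hy; apply: (lt_le_trans hy).
  by have := q0 m.+1; lra.
have qc n m : (n <= m)%N -> N ((q m).1 - (q n).1) < (q n).2.
  by move=> /qsub; apply; rewrite /knorm_ball /= subrr knorm0; apply: q0.
have [l al] : exists l : V, (q n).1 @[n --> \oo] --> l.
  apply: cauchy_knorm_cvg => e e0.
  have /cvgr0Pnorm_lt/(_ (e / 2)) : (1 / 2 : R) ^+ n @[n --> \oo] --> (0 : R).
    by apply: cvg_expr; rewrite ger0_norm; lra.
  case=> [|n0 _ h0]; first by rewrite divr_gt0.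
  exists n0 => n m n0n n0m.
  have h : (q n0).2 < e / 2.
    apply: (le_lt_trans (qr n0)); apply: (le_lt_trans (ler_norm _)).
    by apply: h0 => /=.
  rewrite (le_lt_trans (knorm_triangle k (q n0).1 _ _)) // [X in _ + X]knorm_distC.
  move: (qc _ _ n0n) (qc _ _ n0m); lra.
have [n Fnl] := Fx l.
have : knorm_ball (q n.+1).1 (2 * (q n.+1).2) l.
  rewrite /knorm_ball /=; move/(cvg_knormP k): al => /(_ _ (q0 n.+1))[m _ hm].
  rewrite (le_lt_trans (knorm_triangle k (q (maxn m n.+1)).1 _ _)) // knorm_distC.
  have := qc n.+1 _ (leq_maxr m n.+1); have := hm _ (leq_maxl m n.+1).
  by rewrite /=; lra.
by case: (gP (n, q n) (q0 n)) => /= _ _ _ /[apply].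
Qed.

End complete.

(** * The Bochner integral *)

Section simple.
Context (R : realType).
Let mu := @lebesgue_measure R.
Local Notation D t := (`[0%R, t]%classic : set (measurableTypeR R)).

(* Convertible to [simple_function] when [T] is a normed module; pairs of simple
   functions and indicators also fit. *)
Definition finitely_valued (T : Type) (p : R -> T) :=
  finite_set (range p) /\
  forall w, measurable (p @^-1` [set w] : set (measurableTypeR R)).

Lemma finitely_valued_preimage (T : Type) (p : R -> T) (A : set T) :
  finitely_valued p -> measurable (p @^-1` A : set (measurableTypeR R)).
Proof.
move=> [pf pm].
rewrite (_ : p @^-1` A = \bigcup_(w in range p `&` A) p @^-1` [set w]).
  by apply: fin_bigcup_measurable => //; exact: finite_setIl.
apply/seteqP; split=> [r /= Apr|r [w [_ Aw] /= ->]//].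
by exists (p r) => //; split=> //; exists r.
Qed.

Lemma finitely_valued_comp (T T' : Type) (p : R -> T) (G : T -> T') :
  finitely_valued p -> finitely_valued (G \o p).
Proof.
move=> fp; split.
  2: by move=> w; rewrite comp_preimage; exact: finitely_valued_preimage.
have -> : range (G \o p) = G @` range p by rewrite image_comp.
by apply: finite_image; case: fp.
Qed.

Lemma finitely_valued_pair (T T' : Type) (p : R -> T) (q : R -> T') :
  finitely_valued p -> finitely_valued q ->
  finitely_valued (fun r => (p r, q r)).
Proof.
move=> fp fq; split; last first.
  move=> [a b]; rewrite (_ : _ @^-1` _ = p @^-1` [set a] `&` q @^-1` [set b]).
    by apply: measurableI; [case: fp|case: fq].
  by apply/seteqP; split=> r /= [] => [-> ->//|-> ->].
apply: (@sub_finite_set _ _ (range p `*` range q)).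
  by move=> _ [r _ <-]; split; exists r.
by apply: finite_setX; [case: fp|case: fq].
Qed.

Lemma finitely_valued_measurable (p : R -> R) (A : set (measurableTypeR R)) :
  finitely_valued p -> measurable_fun A (p : measurableTypeR R -> measurableTypeR R).
Proof.
move=> fp mA Y mY; apply: measurableI => //.
exact: finitely_valued_preimage.
Qed.

Definition level (t : R) (T : Type) (p : R -> T) (A : set T) : R :=
  fine (mu (D t `&` p @^-1` A)).

Lemma level_ge0 t (T : Type) (p : R -> T) (A : set T) : 0 <= level t p A.
Proof. by rewrite /level fine_ge0. Qed.

Lemma level_fin t (T : Type) (p : R -> T) (A : set T) : finitely_valued p ->
  mu (D t `&` p @^-1` A) = (level t p A)%:E.
Proof.
move=> fp; rewrite fineK // ge0_fin_numE //.
have mA : measurable (D t `&` p @^-1` A : set (measurableTypeR R)).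
  by apply: measurableI => //; exact: finitely_valued_preimage.
apply: (@le_lt_trans _ _ (mu (D t))).
  by apply: le_measure => //; exact/mem_set.
by rewrite /mu lebesgue_measure_itv /=; case: ifP => _; rewrite -?EFinD ltry.
Qed.

Lemma level_sum t (T : choiceType) (p : R -> T) (A : set T) :
  finitely_valued p ->
  level t p A = \sum_(w <- fset_set (range p) | w \in A) level t p [set w].
Proof.
move=> fp; apply: EFin_inj; rewrite -level_fin //.
have fr : finite_set (range p) by case: fp.
rewrite (_ : D t `&` _ =
    \bigcup_(w in range p `&` A) (D t `&` p @^-1` [set w])); last first.
  apply/seteqP; split=> [r /= [Dr Apr]|r [w [_ Aw] /= [Dr ->]]//].
  by exists (p r) => //; split=> //; exists r.
etransitivity.
  apply: (@measure_fin_bigcup _ _ _ mu) => [|i j _ _ [r [/= [_ <-] [_ <-]]] //|i _].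
    exact: finite_setIl.
  by apply: measurableI => //; case: fp.
rewrite fsbig_mkcondr fsbig_finite // -sumEFin [in RHS]big_mkcond /=.
by apply: eq_bigr => w _; case: ifP => // _; exact: level_fin.
Qed.

End simple.

Section simple_integral.
Context (R : realType) (K : numFieldType) (k : scalar_field R K).
Context (V : normedModType K).
Let mu := @lebesgue_measure R.
Local Notation D t := (`[0%R, t]%classic : set (measurableTypeR R)).
Local Notation N := (norm k).

Lemma of_real_sum (I : Type) (r : seq I) (P : pred I) (F : I -> R) :
  of_real k (\sum_(i <- r | P i) F i) = \sum_(i <- r | P i) of_real k (F i).
Proof. by apply: big_morph; [exact: of_realD|exact: of_real0]. Qed.

(** Grouping the values of [p] by the fibres of [G] turns the sum over the range of [G \o p] into a
    sum over the range of [p]. Two simple functions then share one index set, the range of their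
    pair, whence additivity of the integral. *)
Lemma simple_integral_comp t (T : choiceType) (p : R -> T) (G : T -> V) :
  finitely_valued p ->
  simple_integral k t (G \o p) =
  \sum_(w <- fset_set (range p)) of_real k (level t p [set w]) *: G w.
Proof.
move=> fp; have fr : finite_set (range p) by case: fp.
have fGp : finitely_valued (G \o p) by exact: finitely_valued_comp.
have frG : finite_set (range (G \o p)) by case: fGp.
rewrite /simple_integral fsbig_finite //=.
transitivity (\sum_(y <- fset_set (range (G \o p)))
    \sum_(w <- fset_set (range p))
      if G w == y then of_real k (level t p [set w]) *: G w else 0).
  apply: eq_bigr => y _; rewrite -big_mkcond /=.
  rewrite (_ : fine _ = level t p (G @^-1` [set y])) // level_sum //.
  rewrite of_real_sum scaler_suml.
  have e w : (w \in G @^-1` [set y]) = (G w == y).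
    by apply/idP/idP => [/set_mem /= ->//|/eqP h]; apply/mem_set.
  apply: eq_big => [w|w wy]; first exact: e.
  by move: wy; rewrite e => /eqP ->.
rewrite exchange_big /=; apply: eq_big_seq => w wp.
have Gw : G w \in fset_set (range (G \o p)).
  rewrite in_fset_set //; apply/mem_set.
  by move: wp; rewrite in_fset_set // => /set_mem [r _ <-]; exists r.
rewrite (bigD1_seq (G w)) ?fset_uniq //= eqxx big1 ?addr0 // => y.
by rewrite eq_sym => /negbTE ->.
Qed.

Lemma simple_integral_lin t (s1 s2 : R -> V) (a : R) :
  finitely_valued s1 -> finitely_valued s2 ->
  simple_integral k t (fun r => of_real k a *: s1 r + s2 r) =
  of_real k a *: simple_integral k t s1 + simple_integral k t s2.
Proof.
move=> f1 f2; pose p r := (s1 r, s2 r).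
have fp : finitely_valued p by exact: finitely_valued_pair.
have := simple_integral_comp t (fun w => of_real k a *: w.1 + w.2) fp.
rewrite (_ : _ \o p = fun r => of_real k a *: s1 r + s2 r) // => ->.
have := simple_integral_comp t fst fp; rewrite (_ : _ \o p = s1) // => ->.
have := simple_integral_comp t snd fp; rewrite (_ : _ \o p = s2) // => ->.
rewrite scaler_sumr -big_split /=; apply: eq_bigr => w _.
by rewrite scalerDr !scalerA mulrC.
Qed.

End simple_integral.

Section simple_integral_norm.
Context (R : realType) (K : numFieldType) (k : scalar_field R K).
Context (V : normedModType K).
Let mu := @lebesgue_measure R.
Local Notation D t := (`[0%R, t]%classic : set (measurableTypeR R)).
Local Notation N := (norm k).

Lemma simple_integral_norm t (s : R -> V) : finitely_valued s ->
  ((N (simple_integral k t s))%:E <= \int[mu]_(r in D t) (N (s r))%:E)%E.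
Proof.
move=> fs; have fr : finite_set (range s) by case: fs.
have -> : (\int[mu]_(r in D t) (N (s r))%:E =
  \int[mu]_(r in D t) \sum_(y <- fset_set (range s))
      (N y * \1_(s @^-1` [set y]) r)%:E)%E.
  apply: eq_integral => r _; rewrite sumEFin; congr EFin.
  rewrite (bigD1_seq (s r)) ?fset_uniq //=; last first.
    by rewrite in_fset_set //; apply/mem_set; exists r.
  rewrite indicE mem_set // mulr1 big1 ?addr0 // => y ysr.
  rewrite indicE memNset ?mulr0 // => /= e; move: ysr; by rewrite e eqxx.
rewrite ge0_integral_sum //; first last.
- by move=> y r _; rewrite lee_fin mulr_ge0 // knorm_ge0.
- move=> y; apply/measurable_EFinP; apply: measurable_funM => //.
  by apply: measurable_indic; case: fs.
have -> : simple_integral k t s = simple_integral k t (id \o s) by [].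
rewrite simple_integral_comp //.
apply: (@le_trans _ _ (\sum_(y <- fset_set (range s)) (level t s [set y] * N y))%:E).
  rewrite lee_fin; elim: (finmap.enum_fset _) => [|y r ih].
    by rewrite !big_nil knorm0.
  rewrite !big_cons (le_trans (knormD_le _ _ _)) // lerD //.
  by rewrite knormZ_real ger0_norm // level_ge0.
rewrite -sumEFin; apply: lee_sum => y _.
under eq_integral do rewrite EFinM.
rewrite ge0_integralZl //; first last.
- by rewrite lee_fin knorm_ge0.
- by apply/measurable_EFinP; apply: measurable_indic; case: fs.
rewrite integral_indic //; last by case: fs.
by rewrite setIC EFinM muleC -(level_fin t _ fs).
Qed.

End simple_integral_norm.

Section strongly_measurable.
Context (R : realType) (K : numFieldType) (k : scalar_field R K).
Context (V : normedModType K).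
Let mu := @lebesgue_measure R.
Local Notation D t := (`[0%R, t]%classic : set (measurableTypeR R)).
Local Notation N := (norm k).

Lemma simple_strongly_measurable t (s : R -> V) :
  simple_function s -> strongly_measurable t s.
Proof. by move=> ss; exists (fun=> s); split=> // r _; exact: cvg_cst. Qed.

Lemma simple_lin (a : K) (s1 s2 : R -> V) :
  simple_function s1 -> simple_function s2 ->
  simple_function (fun r => a *: s1 r + s2 r).
Proof.
move=> f1 f2.
exact: (finitely_valued_comp (fun w => a *: w.1 + w.2) (finitely_valued_pair f1 f2)).
Qed.

Lemma strongly_measurable_lin t (a : K) (g h : R -> V) :
  strongly_measurable t g -> strongly_measurable t h ->
  strongly_measurable t (fun r => a *: g r + h r).
Proof.
move=> [s1 [ss1 s1g]] [s2 [ss2 s2h]].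
exists (fun n r => a *: s1 n r + s2 n r); split=> [n|r tr].
  exact: simple_lin.
apply: cvgD; last exact: s2h.
by apply: cvgZr; exact: s1g.
Qed.

Lemma strongly_measurableB t (g h : R -> V) :
  strongly_measurable t g -> strongly_measurable t h ->
  strongly_measurable t (g \- h).
Proof.
move=> mg mh; have := strongly_measurable_lin (-1) mh mg.
by under [X in strongly_measurable t X]funext do rewrite scaleN1r addrC.
Qed.

Lemma strongly_measurable_le t t' (g : R -> V) : t' <= t ->
  strongly_measurable t g -> strongly_measurable t' g.
Proof.
move=> tt [s [ss sg]]; exists s; split=> // r /andP[r0 rt].
by apply: sg; rewrite r0 (le_trans rt).
Qed.

Lemma measurable_norm t (g : R -> V) : strongly_measurable t g ->
  measurable_fun (D t) (fun r => N (g r)).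
Proof.
move=> [s [ss sg]].
apply: (@measurable_fun_cvg _ _ _ _ (fun n r => N (s n r))) => [n|r] /=.
  by apply: finitely_valued_measurable; exact: (finitely_valued_comp _ (ss n)).
by rewrite in_itv /= => /sg /cvg_knorm.
Qed.

Lemma measurable_normE t (g : R -> V) : strongly_measurable t g ->
  measurable_fun (D t) (fun r => (N (g r))%:E).
Proof. by move=> mg; apply/measurable_EFinP; exact: measurable_norm. Qed.

End strongly_measurable.

Section bochner.
Context (R : realType) (K : numFieldType) (k : scalar_field R K).
Context (V : normedModType K).
Let mu := @lebesgue_measure R.
Local Notation D t := (`[0%R, t]%classic : set (measurableTypeR R)).
Local Notation N := (norm k).
Local Notation bochner := (@has_bochner_integral R K k V).

Lemma of_realN1 : of_real k (-1) = -1.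
Proof.
by apply/eqP; rewrite -addr_eq0 -[in X in _ + X](of_real1 k) -of_realD addNr of_real0.
Qed.

Lemma integral_norm_ge0 t (g : R -> V) :
  (0 <= \int[mu]_(r in D t) (N (g r))%:E)%E.
Proof. by apply: integral_ge0 => r _; rewrite lee_fin knorm_ge0. Qed.

Lemma integral_norm_lin_le t (a : R) (g h : R -> V) :
  strongly_measurable t g -> strongly_measurable t h ->
  (\int[mu]_(r in D t) (N (of_real k a *: g r + h r))%:E <=
   `|a|%:E * \int[mu]_(r in D t) (N (g r))%:E + \int[mu]_(r in D t) (N (h r))%:E)%E.
Proof.
move=> mg mh; rewrite -ge0_integralZl //; first last.
- by move=> r _; rewrite lee_fin knorm_ge0.
- exact: measurable_normE.
rewrite -ge0_integralD //; first last.
- exact: measurable_normE.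
- by move=> r _; rewrite lee_fin knorm_ge0.
- by apply: measurable_funeM; exact: measurable_normE.
- by move=> r _; rewrite mule_ge0 // lee_fin knorm_ge0.
apply: ge0_le_integral => //.
- by move=> r _; rewrite lee_fin knorm_ge0.
- by apply: measurable_normE; exact: strongly_measurable_lin.
- apply: emeasurable_funD; last exact: measurable_normE.
  by apply: measurable_funeM; exact: measurable_normE.
- move=> r _; rewrite -EFinM -EFinD lee_fin (le_trans (knormD_le _ _ _)) //.
  by rewrite knormZ_real.
Qed.

Lemma bochner_lin t (a : R) g h v w : bochner t g v -> bochner t h w ->
  bochner t (fun r => of_real k a *: g r + h r) (of_real k a *: v + w).
Proof.
move=> [mg [s1 [ss1 s1g s1v]]] [mh [s2 [ss2 s2h s2w]]].
split; first exact: strongly_measurable_lin.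
exists (fun n r => of_real k a *: s1 n r + s2 n r); split.
- by move=> n; exact: simple_lin.
- apply: (@squeeze_cvge _ _ _ _ (cst 0%E) _ (fun n =>
    (`|a|%:E * \int[mu]_(r in D t) (N (g r - s1 n r))%:E +
      \int[mu]_(r in D t) (N (h r - s2 n r))%:E)%E)).
  + apply: nearW => n; apply/andP; split; first exact: integral_norm_ge0.
    apply: (le_trans _ (integral_norm_lin_le _ _ _)).
    * rewrite le_eqVlt; apply/orP; left; apply/eqP; apply: eq_integral => r _.
      congr (N _)%:E.
      by rewrite scalerBr opprD addrACA.
    * by apply: strongly_measurableB => //; exact: simple_strongly_measurable.
    * by apply: strongly_measurableB => //; exact: simple_strongly_measurable.
  + exact: cvg_cst.
  + rewrite -[X in _ --> X](adde0 0%E) -{1}(mule0 `|a|%:E).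
    by apply: cvgeD => //; apply: cvgeZl.
- have -> : (fun n => simple_integral k t (fun r => of_real k a *: s1 n r + s2 n r)) =
     (fun n => of_real k a *: simple_integral k t (s1 n) + simple_integral k t (s2 n)).
    by apply/funext => n; rewrite simple_integral_lin //; [exact: ss1|exact: ss2].
  by apply: cvgD => //; apply: cvgZr.
Qed.

Lemma bochnerB t g h v w : bochner t g v -> bochner t h w ->
  bochner t (fun r => g r - h r) (v - w).
Proof.
move=> hg hh; have := bochner_lin (-1) hh hg.
rewrite of_realN1 scaleN1r addrC; congr (bochner _ _ _); apply/funext => r.
by rewrite scaleN1r addrC.
Qed.

Lemma bochnerZ t (a : R) g v : bochner t g v ->
  bochner t (fun r => of_real k a *: g r) (of_real k a *: v).
Proof.
(* The summand 0 is written as [g - g], whose integral [v - v] is already available. *)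
move=> hg; have := bochner_lin a hg (bochnerB hg hg).
by rewrite subrr addr0; congr (bochner _ _ _); apply/funext => r; rewrite subrr addr0.
Qed.

(** For simple functions this is the triangle inequality, and the integral of [N (g r - s n r)]
    vanishes in the limit. The right-hand side may be infinite, so integrability of the norm need
    not be settled beforehand. *)
Lemma bochner_norm_le t g v : bochner t g v ->
  ((N v)%:E <= \int[mu]_(r in D t) (N (g r))%:E)%E.
Proof.
move=> [mg [s [ss sg sv]]].
have := cvg_knorm (k := k) sv; set I := (X in (_ <= X)%E) => cv.
have cI : (I + \int[mu]_(r in D t) (N (g r - s n r))%:E)%E @[n --> \oo] --> I.
  rewrite -[X in _ --> X]adde0; apply: cvgeD => //; last exact: cvg_cst.
  by rewrite fin_num_adde_defl.
have cvE : (N (simple_integral k t (s n)))%:E @[n --> \oo] --> (N v)%:E.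
  by apply: cvg_EFin; [near=> n|exact: cv].
apply: lee_cvg_to cvE cI _.
apply: nearW => n /=; apply: (le_trans (simple_integral_norm _ _ (ss n))).
have := integral_norm_lin_le (-1)
  (strongly_measurableB mg (simple_strongly_measurable t (ss n))) mg.
rewrite normrN normr1 mul1e addeC; apply: le_trans.
rewrite le_eqVlt; apply/orP; left; apply/eqP; apply: eq_integral => r _ /=.
by rewrite of_realN1 scaleN1r opprB subrK.
Unshelve. all: by end_near.
Qed.

End bochner.

(** * L2 spaces *)

Section L2.
Context (R : realType) (K : numFieldType) (k : scalar_field R K).
Context (V : normedModType K).
Let mu := @lebesgue_measure R.
Local Notation D t := (`[0%R, t]%classic : set (measurableTypeR R)).
Local Notation N := (norm k).
Local Notation sqint t u := (\int[mu]_(r in D t) (norm k (u r) ^+ 2)%:E)%E.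

Lemma lebesgue_measure_Icc t : 0 <= t -> mu (D t) = t%:E.
Proof.
move=> t0; rewrite /mu lebesgue_measure_itv /= lte_fin.
by case: ltP => [_|tle]; [rewrite -EFinB subr0|congr EFin; lra].
Qed.

Lemma sqint_ge0 t (u : R -> V) : (0 <= sqint t u)%E.
Proof. by apply: integral_ge0 => r _; rewrite lee_fin exprn_ge0 // knorm_ge0. Qed.

Lemma measurable_sqnormE t (g : R -> V) : strongly_measurable t g ->
  measurable_fun (D t) (fun r => (N (g r) ^+ 2)%:E).
Proof.
move=> mg; apply/measurable_EFinP; apply: measurable_funX.
exact: measurable_norm.
Qed.

(** Reduces L2 estimates to pointwise quadratic inequalities; a bound by a single function takes
    [c2 := 0]. *)
Lemma sqint_le t (c1 c2 : R) (u v w : R -> V) :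
  strongly_measurable t u -> strongly_measurable t v -> strongly_measurable t w ->
  0 <= c1 -> 0 <= c2 ->
  (forall r, N (w r) ^+ 2 <= c1 * N (u r) ^+ 2 + c2 * N (v r) ^+ 2) ->
  (sqint t w <= c1%:E * sqint t u + c2%:E * sqint t v)%E.
Proof.
move=> mu_ mv mw c10 c20 h.
have pos (x : R -> V) r : (0 <= (N (x r) ^+ 2)%:E)%E.
  by rewrite lee_fin exprn_ge0 // knorm_ge0.
rewrite -!ge0_integralZl //; try exact: measurable_sqnormE.
have mZ c (x : R -> V) : strongly_measurable t x ->
    measurable_fun (D t) (fun r => (c%:E * (N (x r) ^+ 2)%:E)%E).
  by move=> mx; apply: measurable_funeM; exact: measurable_sqnormE.
rewrite -ge0_integralD //; try (by apply: mZ); first last.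
- by move=> r _; rewrite mule_ge0.
- by move=> r _; rewrite mule_ge0.
apply: ge0_le_integral => //.
- exact: measurable_sqnormE.
- by apply: emeasurable_funD; apply: mZ.
- by move=> r _; rewrite -!EFinM -EFinD lee_fin.
Qed.

Lemma L2normE t (u : R -> V) : L2 k t u -> sqint t u = (L2norm k t u ^+ 2)%:E.
Proof.
move=> [_ hu]; rewrite /L2norm sqr_sqrtr; last by rewrite fine_ge0 // sqint_ge0.
by rewrite fineK // ge0_fin_numE // sqint_ge0.
Qed.

Lemma L2norm_ge0 t (u : R -> V) : 0 <= L2norm k t u.
Proof. exact: sqrtr_ge0. Qed.

Lemma L2norm_le t (u : R -> V) (c : R) : 0 <= c ->
  (sqint t u <= (c ^+ 2)%:E)%E -> L2norm k t u <= c.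
Proof.
move=> c0 h; rewrite /L2norm.
rewrite -[leRHS]ger0_norm // -[leRHS]sqrtr_sqr ler_sqrt ?exprn_ge0 //.
by rewrite -lee_fin fineK // ge0_fin_numE ?sqint_ge0 // (le_lt_trans h) ?ltry.
Qed.

Lemma L2B t (u v : R -> V) : L2 k t u -> L2 k t v -> L2 k t (u \- v).
Proof.
move=> hu hv; have [mu_ _] := hu; have [mv _] := hv.
split; first exact: strongly_measurableB.
apply: (@le_lt_trans _ _ (2%:E * sqint t u + 2%:E * sqint t v)%E); last first.
  by rewrite !L2normE // -!EFinM -EFinD ltry.
apply: sqint_le => //; first exact: strongly_measurableB.
move=> r /=; apply: (@le_trans _ _ ((N (u r) + N (v r)) ^+ 2)).
  by rewrite lerXn2r ?nnegrE ?addr_ge0 ?knorm_ge0 // knormB_le.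
have := sqr_ge0 (N (u r) - N (v r)); rewrite sqrrB sqrrD; lra.
Qed.

Lemma L2Z t (a : K) (u : R -> V) : L2 k t u -> L2 k t (fun r => a *: u r).
Proof.
move=> hu; have [mu_ _] := hu.
have mau : strongly_measurable t (fun r => a *: u r).
  have := strongly_measurable_lin a mu_ (strongly_measurableB mu_ mu_).
  by congr (strongly_measurable t _); apply/funext => r /=; rewrite subrr addr0.
split => //.
have : (sqint t (fun r => a *: u r) <=
    (scalar_re k `|a| ^+ 2)%:E * sqint t u + 0%:E * sqint t u)%E.
  apply: sqint_le => // [|r].
    by rewrite exprn_ge0 // -(of_real_le k) scalar_reK // of_real0.
  by rewrite knormZ exprMn mul0r addr0.
by move=> /le_lt_trans; apply; rewrite mul0e adde0 L2normE // -EFinM ltry.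
Qed.

Lemma L2normZ_le t (a : R) (u : R -> V) : L2 k t u ->
  L2norm k t (fun r => of_real k a *: u r) <= `|a| * L2norm k t u.
Proof.
move=> hu; have [mu_ _] := hu; have [mau _] := L2Z (of_real k a) hu.
apply: L2norm_le; first by rewrite mulr_ge0 // L2norm_ge0.
rewrite exprMn EFinM -L2normE // -[leRHS]adde0 -(mul0e (sqint t u)).
by apply: sqint_le => // r; rewrite knormZ_real exprMn mul0r addr0.
Qed.

(** Minkowski from a weighted Young inequality: with A and B the two norms, (x + y)^2 <= (1 + B/A)
    x^2 + (1 + A/B) y^2 integrates to (A + B)^2. The slack [e] keeps the weights meaningful when a
    norm is 0. *)
Lemma L2norm_triangle t (u v : R -> V) : L2 k t u -> L2 k t v ->
  L2norm k t (u \- v) <= L2norm k t u + L2norm k t v.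
Proof.
move=> hu hv; have [mu_ _] := hu; have [mv _] := hv.
apply/ler_addgt0Pr => e e0.
set A := L2norm k t u; set B := L2norm k t v.
have A0 : 0 <= A by exact: L2norm_ge0.
have B0 : 0 <= B by exact: L2norm_ge0.
pose A' := A + e / 2; pose B' := B + e / 2.
have A'0 : 0 < A' by rewrite /A'; lra.
have B'0 : 0 < B' by rewrite /B'; lra.
rewrite (_ : A + B + e = A' + B'); last by rewrite /A' /B'; lra.
apply: L2norm_le; first by rewrite addr_ge0 // ltW.
have c1 : 0 <= 1 + B' / A' by rewrite addr_ge0 // divr_ge0 // ltW.
have c2 : 0 <= 1 + A' / B' by rewrite addr_ge0 // divr_ge0 // ltW.
apply: (@le_trans _ _ ((1 + B' / A')%:E * sqint t u + (1 + A' / B')%:E * sqint t v)%E).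
  apply: sqint_le => // [|r]; first exact: strongly_measurableB.
  apply: (@le_trans _ _ ((N (u r) + N (v r)) ^+ 2)).
    by rewrite lerXn2r ?nnegrE ?addr_ge0 ?knorm_ge0 // knormB_le.
  set x := N (u r); set y := N (v r).
  have -> : (1 + B' / A') * x ^+ 2 + (1 + A' / B') * y ^+ 2 =
     (x + y) ^+ 2 + (B' * x - A' * y) ^+ 2 / (A' * B').
    by field; rewrite !gt_eqF.
  by rewrite lerDl divr_ge0 ?sqr_ge0 // mulr_ge0 // ltW.
rewrite !L2normE // -!EFinM -EFinD lee_fin -/A -/B.
apply: (@le_trans _ _ ((1 + B' / A') * A' ^+ 2 + (1 + A' / B') * B' ^+ 2)).
  rewrite lerD // ler_wpM2l // lerXn2r ?nnegrE ?(ltW A'0) ?(ltW B'0) //.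
    by rewrite /A' lerDl; lra.
  by rewrite /B' lerDl; lra.
rewrite le_eqVlt; apply/orP; left; apply/eqP.
by field; rewrite !gt_eqF.
Qed.

Lemma L2norm_distC t (u v : R -> V) : L2norm k t (u \- v) = L2norm k t (v \- u).
Proof.
by congr (Num.sqrt (fine _)); apply: eq_integral => r _ /=; rewrite knorm_distC.
Qed.

Lemma L2norm_sub_le t (v u w : R -> V) : L2 k t u -> L2 k t v -> L2 k t w ->
  L2norm k t (u \- w) <= L2norm k t (u \- v) + L2norm k t (v \- w).
Proof.
move=> hu hv hw.
have -> : u \- w = (u \- v) \- (w \- v).
  by apply/funext => r /=; rewrite opprB addrA subrK.
apply: (le_trans (L2norm_triangle _ _)); [exact: L2B|exact: L2B|].
by rewrite lerD2l L2norm_distC.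
Qed.

(* The crude constant [1 + t] stands for the sharp [Num.sqrt t], since
   AM-GM then replaces Hoelder's inequality. *)
Lemma integral_norm_le_L2norm t (u : R -> V) : 0 <= t -> L2 k t u ->
  (\int[mu]_(r in D t) (N (u r))%:E <= ((1 + t) * L2norm k t u)%:E)%E.
Proof.
move=> t0 hu; have [mu_ _] := hu.
apply/lee_addgt0Pr => e e0.
(* AM-GM enters as x <= x^2 / l + l. Raising the norm by [e / (1 + t)] keeps [l] positive when the
   norm is 0 and costs exactly [e] in the end. *)
set L := L2norm k t u; pose l := L + e / (1 + t).
have L0 : 0 <= L by exact: L2norm_ge0.
have t1 : 0 < 1 + t by lra.
have l0 : 0 < l by rewrite /l ltr_wpDl // divr_gt0.
apply: (@le_trans _ _ (\int[mu]_(r in D t) (l^-1%:E * (N (u r) ^+ 2)%:E + l%:E))%E).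
  apply: ge0_le_integral => //.
  - by move=> r _; rewrite lee_fin knorm_ge0.
  - exact: measurable_normE.
  - by apply: emeasurable_funD => //; apply: measurable_funeM; exact: measurable_sqnormE.
  move=> r _; rewrite -EFinM -EFinD lee_fin.
  set x := N (u r).
  rewrite -(ler_pM2l l0) mulrDr mulrA divff ?gt_eqF // mul1r.
  have := sqr_ge0 (x - l); have := sqr_ge0 x; have := sqr_ge0 l; rewrite sqrrB !expr2; lra.
have pos r : (0 <= (N (u r) ^+ 2)%:E)%E by rewrite lee_fin exprn_ge0 // knorm_ge0.
rewrite ge0_integralD //; first last.
- by move=> r _; rewrite lee_fin ltW.
- by apply: measurable_funeM; exact: measurable_sqnormE.
- by move=> r _; rewrite mule_ge0 // lee_fin invr_ge0 ltW.
rewrite ge0_integralZl //; first last.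
- by rewrite lee_fin invr_ge0 ltW.
- exact: measurable_sqnormE.
have -> : (\int[mu]_(r in D t) l%:E)%E = (l * t)%:E.
  rewrite integral_cst // EFinM; congr (_ * _)%E; exact: lebesgue_measure_Icc.
rewrite L2normE // -/L -!EFinM -!EFinD lee_fin.
apply: (@le_trans _ _ (l^-1 * l ^+ 2 + l * t)).
  rewrite lerD2r ler_wpM2l ?invr_ge0 ?(ltW l0) // lerXn2r ?nnegrE // ?(ltW l0) //.
  by rewrite /l lerDl divr_ge0 // ltW.
rewrite expr2 mulrA mulVf ?gt_eqF // mul1r /l mulrDl.
rewrite le_eqVlt; apply/orP; left; apply/eqP; field; by rewrite gt_eqF.
Qed.

End L2.

(** * Density of simple functions in L2 *)

Section L2_simple.
Context (R : realType) (K : numFieldType) (k : scalar_field R K).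
Context (V : normedModType K).
Let mu := @lebesgue_measure R.
Local Notation D t := (`[0%R, t]%classic : set (measurableTypeR R)).
Local Notation N := (norm k).

Lemma finitely_valued_mem (A : set (measurableTypeR R)) :
  measurable A -> finitely_valued (fun r : R => r \in A).
Proof.
move=> mA; split; first exact: finite_finset.
move=> [].
  rewrite (_ : _ @^-1` _ = A) //; apply/seteqP.
  by split=> r /= => [/set_mem|/mem_set].
rewrite (_ : _ @^-1` _ = ~` A); first exact: measurableC.
by apply/seteqP; split=> r /= => [/negbT/negP h /mem_set|h]; last exact: memNset.
Qed.

Lemma simple_cut (A : set (measurableTypeR R)) (s : R -> V) :
  measurable A -> simple_function s ->
  simple_function (fun r => if r \in A then s r else 0).
Proof.
move=> mA ss.
exact: (finitely_valued_comp (fun w : bool * V => if w.1 then w.2 else 0)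
  (finitely_valued_pair (finitely_valued_mem mA) ss)).
Qed.

Lemma L2_simple_approx t (u : R -> V) (e : R) : L2 k t u -> 0 < e ->
  exists w : R -> V, [/\ simple_function w, L2 k t w & L2norm k t (u \- w) < e].
Proof.
move=> hu e0; have [mu_ Iu] := hu; have [s [ss su]] := mu_.
(* Cutting [s n] where it exceeds [2 N u] makes [3 N u] dominate the error. *)
pose A n : set (measurableTypeR R) :=
  D t `&` [set r | N (s n r) - 2 * N (u r) <= 0].
have mA n : measurable (A n).
  have mf : measurable_fun (D t) (fun r => N (s n r) - 2 * N (u r)).
    apply: measurable_funB; last apply: measurable_funM => //.
      exact: measurable_norm (simple_strongly_measurable t (ss n)).
    exact: measurable_norm.
  move: (mf (measurable_itv _) `]-oo, 0]%classic (measurable_itv _)).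
  by rewrite (_ : _ `&` _ = A n).
pose w n r := if r \in A n then s n r else 0.
have sw n : simple_function (w n) by exact: simple_cut.
have mw n : strongly_measurable t (w n) by exact: simple_strongly_measurable.
have muw n : strongly_measurable t (u \- w n) by exact: strongly_measurableB.
have wu n r : D t r -> N (u r - w n r) <= 3 * N (u r).
  move=> Dr; rewrite /w; case: ifPn => [/set_mem [_ /= h]|_].
    by rewrite (le_trans (knormB_le _ _ _)) //; lra.
  by rewrite subr0; have := knorm_ge0 k (u r); lra.
have wc r : D t r -> N (u r - w n r) @[n --> \oo] --> (0 : R).
  move=> Dr; have := su r; rewrite /= in_itv /= in Dr; move=> /(_ Dr) sr.
  (* Where [N (u r)] is 0, domination by [3 * N (u r)] makes the error 0; elsewhere [s n r] is
     eventually within [N (u r)] of [u r], so it is not cut. *)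
  have [u0|u0] := eqVneq (N (u r)) 0.
    rewrite (_ : (fun n => N (u r - w n r)) = cst 0); first exact: cvg_cst.
    apply/funext => n; apply/eqP; rewrite eq_le knorm_ge0 andbT.
    by rewrite (le_trans (wu n r _)) ?u0 ?mulr0 //= in_itv.
  have up : 0 < N (u r) by rewrite lt_neqAle eq_sym u0 knorm_ge0.
  apply/cvgr0Pnorm_lt => d d0.
  have /(cvg_knormP k)/(_ (Num.min d (N (u r)))) := sr.
  rewrite lt_min d0 up => /(_ isT); apply: filterS => n.
  rewrite lt_min => /andP[h1 h2].
  rewrite ger0_norm ?knorm_ge0 // /w mem_set; first by rewrite knorm_distC.
  split; first by rewrite /= in_itv.
  have := knorm_dist_le k (s n r) (u r); rewrite ler_norml => /andP[_ h3] /=; lra.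
have D9 : mu.-integrable (D t) (fun r => (9 * N (u r) ^+ 2)%:E).
  apply/integrableP; split.
    apply/measurable_EFinP; apply: measurable_funM => //; apply/measurable_funX.
    exact: measurable_norm.
  have -> : (\int[mu]_(r in D t) `|(9 * N (u r) ^+ 2)%:E|)%E =
      (9%:E * \int[mu]_(r in D t) (N (u r) ^+ 2)%:E)%E.
    rewrite -ge0_integralZl //; first last.
    - by move=> r _; rewrite lee_fin exprn_ge0 // knorm_ge0.
    - exact: measurable_sqnormE.
    apply: eq_integral => r _; rewrite abse_EFin EFinM ger0_norm //.
    by rewrite mulr_ge0 // exprn_ge0 // knorm_ge0.
  by rewrite (L2normE hu) -EFinM ltry.
have f_f : {ae mu, forall r, D t r ->
    (N (u r - w n r) ^+ 2)%:E @[n --> \oo] --> (0%:E : \bar R)}.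
  apply: aeW => r Dr; apply: cvg_EFin; first exact: nearW.
  have := cvgM (wc r Dr) (wc r Dr); rewrite mul0r => h.
  exact: h _.
have f_g : {ae mu, forall r n, D t r ->
    (`|(N (u r - w n r) ^+ 2)%:E| <= (9 * N (u r) ^+ 2)%:E)%E}.
  apply: aeW => r n Dr; rewrite abse_EFin lee_fin ger0_norm ?exprn_ge0 ?knorm_ge0 //.
  rewrite (_ : 9 * _ = (3 * N (u r)) ^+ 2); last by ring.
  by rewrite lerXn2r ?nnegrE ?mulr_ge0 ?knorm_ge0 // wu.
have [_ _] := @dominated_convergence _ _ _ mu (D t) (measurable_itv _)
  (fun n r => (N (u r - w n r) ^+ 2)%:E) (cst 0%E) (fun r => (9 * N (u r) ^+ 2)%:E)
  (fun n => measurable_sqnormE k (muw n)) (measurable_cst _) f_f D9 f_g.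
rewrite integral0 => cv.
have [n0 _ hn0] : \forall n \near \oo,
    (\int[mu]_(r in D t) (N (u r - w n r) ^+ 2)%:E < (e ^+ 2 / 4)%:E)%E.
  have /(_ `]-oo, (e ^+ 2 / 4)%:E[%classic) := cv; apply.
  apply: open_nbhs_nbhs; split; first exact: open_ereal_lt_ereal.
  by rewrite /= in_itv /= lte_fin divr_gt0 // exprn_gt0.
have hn := hn0 n0 (leqnn _).
have Luw : L2 k t (u \- w n0).
  by split; [exact: muw|rewrite (lt_trans hn) // ltry].
exists (w n0); split => //.
  rewrite (_ : w n0 = u \- (u \- w n0)); first exact: L2B.
  by apply/funext => r /=; rewrite opprB addrC subrK.
apply: (@le_lt_trans _ _ (e / 2)); last by lra.
apply: L2norm_le; first by rewrite divr_ge0 // ltW.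
apply: (le_trans (ltW hn)); rewrite lee_fin le_eqVlt; apply/orP; left; apply/eqP.
by field.
Qed.

End L2_simple.

(** * Completeness of L2 *)

Section L2_complete.
Context (R : realType) (K : numFieldType) (k : scalar_field R K).
Context (V : completeNormedModType K).
Let mu := @lebesgue_measure R.
Local Notation D t := (`[0%R, t]%classic : set (measurableTypeR R)).
Local Notation N := (norm k).
Implicit Types (u v w : R -> V).

Lemma summable_knorm_cvg (a : nat -> V) :
  (\sum_(0 <= n <oo) (N (a n.+1 - a n))%:E < +oo)%E ->
  exists l : V, a n @[n --> \oo] --> l.
Proof.
move=> h; apply: (cauchy_knorm_cvg (k := k)) => e e0.
have : cvgn (series (fun n => N (a n.+1 - a n))).
  apply: nondecreasing_is_cvgn.
    by apply: nondecreasing_series => n _ _; exact: knorm_ge0.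
  exists (fine (\sum_(0 <= n <oo) (N (a n.+1 - a n))%:E)%E) => _ [n _ <-].
  rewrite -lee_fin fineK; last first.
    by rewrite ge0_fin_numE // nneseries_ge0 // => i _ _; rewrite lee_fin knorm_ge0.
  rewrite /series /= -sumEFin; apply: nneseries_lim_ge => i _ _.
  by rewrite lee_fin knorm_ge0.
set S := series _ => /cvg_ex[L /cvgrPdist_lt/(_ (e / 2))[|n0 _ hn0]].
  by rewrite divr_gt0.
have tele m n : (m <= n)%N -> N (a n - a m) <= S n - S m.
  elim: n => [|n ih]; first by rewrite leqn0 => /eqP ->; rewrite !subrr knorm0.
  rewrite leq_eqVlt => /orP[/eqP ->|/ih h']; first by rewrite !subrr knorm0.
  rewrite (le_trans (knorm_triangle k (a n) _ _)) // /S seriesSr -/S; lra.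
exists n0 => n m hn hm; have := hn0 _ hn; have := hn0 _ hm.
rewrite !ltr_distl => /andP[h1 h2] /andP[h3 h4].
have [mn|/ltnW nm] := leqP m n; first by rewrite (le_lt_trans (tele _ _ mn)) //; lra.
by rewrite knorm_distC (le_lt_trans (tele _ _ nm)) //; lra.
Qed.

(** Fatou's lemma in the form that carries an eventual bound on integrals over to a pointwise
    limit. *)
Lemma integral_fatou_le (T : set (measurableTypeR R)) (f_ : nat -> R -> \bar R)
    (f : R -> \bar R) (c : \bar R) : measurable T ->
  (forall n, measurable_fun T (f_ n)) -> (forall n r, T r -> (0 <= f_ n r)%E) ->
  (forall r, T r -> f_ n r @[n --> \oo] --> f r) ->
  (\forall n \near \oo, (\int[mu]_(r in T) f_ n r <= c)%E) ->
  (\int[mu]_(r in T) f r <= c)%E.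
Proof.
move=> mT mf f0 ff fc.
have -> : (\int[mu]_(r in T) f r = \int[mu]_(r in T) limn_einf (f_ ^~ r))%E.
  apply: eq_integral => r /set_mem Tr.
  by have [->] := cvg_limn_einf_sup (ff r Tr).
apply: (le_trans (fatou _ _ _ _)) => //.
rewrite limn_einf_lim; apply: lime_le; first exact: is_cvg_einfs.
case: fc => n0 _ hn0; exists n0 => // n hn; apply: le_trans (hn0 n hn).
by apply: ereal_inf_lbound; exists n => //=.
Qed.

(** Riesz-Fischer with a rate. In the constant, [2 * C] is the tail of the geometric series and 1 is
    the price of replacing [u_ m] by a simple function; the bound passes to the limit in m, with n
    fixed, by Fatou. *)
Lemma L2_complete t (u_ : nat -> R -> V) (C : R) : 0 <= t ->
  (forall n, L2 k t (u_ n)) ->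
  (forall n, L2norm k t (u_ n.+1 \- u_ n) <= C * (1 / 2) ^+ n) ->
  exists2 u, L2 k t u &
    forall n, L2norm k t (u \- u_ n) <= (2 * C + 1) * (1 / 2) ^+ n.
Proof.
move=> t0 Lu hC.
have p0 n : 0 < (1 / 2 : R) ^+ n by rewrite exprn_gt0.
have pS n : (1 / 2 : R) ^+ n.+1 = (1 / 2) ^+ n / 2 by rewrite exprSr mulrA mulr1.
have C0 : 0 <= C.
  by have := hC 0%N; rewrite expr0 mulr1; apply: le_trans; exact: L2norm_ge0.
(* Simple approximations [w n] of [u_ n] converge almost everywhere, because
   their increments have summable integrals; cut to 0 on the null set [bad]
   where they may diverge, they converge everywhere, so that their limit is
   strongly measurable. *)
have [w hw] := choice (fun n => L2_simple_approx (Lu n) (p0 n)).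
have sw n : simple_function (w n) by case: (hw n).
have Lw n : L2 k t (w n) by case: (hw n).
have uw n : L2norm k t (u_ n \- w n) < (1 / 2) ^+ n by case: (hw n).
have dw n : L2norm k t (w n.+1 \- w n) <= (C + 2) * (1 / 2) ^+ n.
  apply: (le_trans (L2norm_sub_le (Lw n.+1) (Lu n.+1) (Lw n))).
  rewrite L2norm_distC.
  have := L2norm_sub_le (Lu n.+1) (Lu n) (Lw n); have := uw n; have := uw n.+1.
  have := hC n; rewrite pS; have := p0 n; lra.
pose d n (r : R) : \bar R := (N (w n.+1 r - w n r))%:E.
have dmeas n : strongly_measurable t (w n.+1 \- w n).
  by apply: strongly_measurableB; exact: simple_strongly_measurable.
have dm n : measurable_fun (D t) (d n) by exact: (measurable_normE k (dmeas n)).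
have d0 n r : (0 <= d n r)%E by rewrite lee_fin knorm_ge0.
have dI n : (\int[mu]_(r in D t) d n r <= ((1 + t) * (C + 2) * (1 / 2) ^+ n)%:E)%E.
  apply: (le_trans (integral_norm_le_L2norm t0 (L2B (Lw n.+1) (Lw n)))).
  by rewrite lee_fin -mulrA ler_wpM2l // addr_ge0.
pose h r := (\sum_(0 <= n <oo) d n r)%E.
have hm : measurable_fun (D t) h.
  exact: (@ge0_emeasurable_sum _ _ _ (D t) d xpredT).
have h0 r : (0 <= h r)%E by apply: nneseries_ge0.
have hI : (\int[mu]_(r in D t) h r < +oo)%E.
  rewrite integral_nneseries //.
  apply: (@le_lt_trans _ _ (\sum_(0 <= n <oo) ((1 + t) * (C + 2) * (1 / 2) ^+ n)%:E)%E).
    apply: lee_nneseries => [n _ _|n _]; [exact: integral_ge0|exact: dI].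
  have q1 : `|1 / 2 : R| < 1 by rewrite ger0_norm //; lra.
  have cg := @cvg_geometric_series _ ((1 + t) * (C + 2)) _ q1.
  have : ((\sum_(0 <= i < n) ((1 + t) * (C + 2) * (1 / 2) ^+ i)%:E)%E @[n --> \oo] -->
     ((1 + t) * (C + 2) / (1 - 1 / 2))%:E).
    under eq_fun do rewrite sumEFin.
    by apply: cvg_EFin; [exact: nearW|exact: cg].
  by move=> /cvg_lim ->; rewrite ?ltry.
pose bad : set (measurableTypeR R) := D t `&` h @^-1` [set +oo%E].
have mbad : measurable bad by apply: hm => //; exact: emeasurable_set1.
have bad0 : mu bad = 0%E.
  have ih : mu.-integrable (D t) h.
    apply/integrableP; split=> //; rewrite (le_lt_trans _ hI) //.
    rewrite le_eqVlt; apply/orP; left; apply/eqP; apply: eq_integral => r _.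
    by rewrite gee0_abs.
  have mD : measurable (D t) by exact: measurable_itv.
  have [M [mM M0 hM]] := integrable_ae mD ih.
  apply/eqP; rewrite eq_le measure_ge0 andbT -M0; apply: le_measure.
  - exact/mem_set.
  - exact/mem_set.
  - by move=> r [Dr /= hr]; apply: hM => /= /(_ Dr); rewrite hr.
pose w' n r := if r \in ~` bad then w n r else 0.
have sw' n : simple_function (w' n).
  by apply: simple_cut => //; exact: measurableC.
have [u hu] : exists u, forall r, D t r -> w' n r @[n --> \oo] --> u r.
  suff /choice[u hu] : forall r, exists l : V, D t r -> w' n r @[n --> \oo] --> l.
    by exists u.
  move=> r; have [Dr|nDr] := pselect (D t r); last by exists 0.
  have [br|nbr] := pselect (bad r).
    exists 0 => _; rewrite (_ : (fun n => w' n r) = cst 0); first exact: cvg_cst.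
    by apply/funext => n; rewrite /w' memNset.
  rewrite (_ : (fun n => w' n r) = w ^~ r); last first.
    by apply/funext => n; rewrite /w' mem_set.
  have [|l hl] := @summable_knorm_cvg (w ^~ r); last by exists l.
  rewrite -/(h r) ltey; apply/eqP => hr; exact: nbr.
have mu_ : strongly_measurable t u.
  by exists w'; split=> // r tr; apply: hu; rewrite /= in_itv.
(* The tail is kept as a difference of powers so that the induction on m telescopes. *)
have step n m : (n <= m)%N ->
    L2norm k t (u_ m \- u_ n) <= 2 * C * ((1 / 2) ^+ n - (1 / 2) ^+ m).
  elim: m => [|m ih].
    rewrite leqn0 => /eqP ->; rewrite subrr mulr0; apply: L2norm_le => //.
    rewrite expr0n /=; under eq_integral do rewrite subrr knorm0 expr0n /=.
    by rewrite integral0.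
  rewrite leq_eqVlt => /orP[/eqP <-|/ih ih'].
    rewrite subrr mulr0; apply: L2norm_le => //.
    rewrite expr0n /=; under eq_integral do rewrite subrr knorm0 expr0n /=.
    by rewrite integral0.
  apply: (le_trans (L2norm_sub_le (Lu m.+1) (Lu m) (Lu n))).
  have := hC m; rewrite pS; lra.
have fin n : (\int[mu]_(r in D t) (N (u r - u_ n r) ^+ 2)%:E <=
    (((2 * C + 1) * (1 / 2) ^+ n) ^+ 2)%:E)%E.
  have [mun _] := Lu n.
  apply: (@integral_fatou_le _ (fun m r => (N (w' m r - u_ n r) ^+ 2)%:E)) => //.
  - move=> m; apply: measurable_sqnormE; apply: strongly_measurableB => //.
    exact: simple_strongly_measurable.
  - by move=> m r _; rewrite lee_fin exprn_ge0 // knorm_ge0.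
  - move=> r Dr; apply: cvg_EFin; first exact: nearW.
    have hc : N (w' m r - u_ n r) @[m --> \oo] --> N (u r - u_ n r).
      by apply: cvg_knorm; apply: cvgB; [exact: hu|exact: cvg_cst].
    exact: (cvgM hc hc).
  exists n => // m /= nm.
  have -> : (\int[mu]_(r in D t) (N (w' m r - u_ n r) ^+ 2)%:E =
     \int[mu]_(r in D t) (N (w m r - u_ n r) ^+ 2)%:E)%E.
    apply: ge0_ae_eq_integral => //.
    - apply: measurable_sqnormE; apply: strongly_measurableB => //.
      exact: simple_strongly_measurable.
    - apply: measurable_sqnormE; apply: strongly_measurableB => //.
      exact: simple_strongly_measurable.
    - by move=> r _; rewrite lee_fin exprn_ge0 // knorm_ge0.
    - by move=> r _; rewrite lee_fin exprn_ge0 // knorm_ge0.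
    - exists bad; split=> // r /= h'; apply: contrapT => nbr; apply: h' => Dr.
      by rewrite /w' mem_set.
  rewrite (L2normE (L2B (Lw m) (Lu n))) lee_fin lerXn2r ?nnegrE ?L2norm_ge0 //.
    by rewrite mulr_ge0 // ?(ltW (p0 n)) //; lra.
  apply: (le_trans (L2norm_sub_le (Lw m) (Lu m) (Lu n))).
  rewrite L2norm_distC; have := uw m; have := step n m nm.
  have : (1 / 2 : R) ^+ m <= (1 / 2) ^+ n by apply: ler_wiXn2l => //; lra.
  have : 0 <= C * (1 / 2) ^+ m by rewrite mulr_ge0 // ltW.
  by rewrite mulrBr mulrDl mul1r => *; lra.
have c0 n : 0 <= (2 * C + 1) * (1 / 2) ^+ n.
  by rewrite mulr_ge0 // ?(ltW (p0 n)) //; lra.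
have Ldiff n : L2 k t (u \- u_ n).
  split; last by rewrite (le_lt_trans (fin n)) // ltry.
  by apply: strongly_measurableB => //; case: (Lu n).
exists u => [|n]; last by apply: L2norm_le => //; exact: fin.
(* Only the differences [u \- u_ n] are known to be in L2 so far; the second bracket is [- u_ 0],
   written with subtractions to suit [L2B]. *)
have -> : u = (u \- u_ 0%N) \- (u_ 0%N \- u_ 0%N \- u_ 0%N).
  by apply/funext => r /=; rewrite subrr sub0r opprK subrK.
by apply: L2B => //; apply: L2B => //; exact: L2B.
Qed.

End L2_complete.

(** * Linear operators, the semigroup and the nonlinearity *)

Section operators.
Context (R : realType) (K : numFieldType) (k : scalar_field R K).
Local Notation N := (norm k).

(** Rescale x to norm [d / 2]. The explicit constant makes the bound uniform over a family of maps,
    as needed for the operators [T t]. *)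
Lemma homogeneous_bound (V : normedModType K) (phi : V -> R) (c d : R) : 0 < d ->
  (forall a x, phi (of_real k a *: x) = `|a| * phi x) ->
  (forall x, N x < d -> phi x <= c) -> forall x, phi x <= 2 * c / d * N x.
Proof.
move=> d0 hphi hc x; have [x0|x0] := eqVneq (N x) 0.
  have -> : x = of_real k 0 *: x by rewrite (knorm0_eq0 x0) scaler0.
  by rewrite hphi knormZ_real normr0 !mul0r mulr0.
have xp : 0 < N x by rewrite lt_neqAle eq_sym x0 knorm_ge0.
pose a := d / (2 * N x).
have a0 : 0 < a by rewrite divr_gt0 // mulr_gt0.
have := hc (of_real k a *: x); rewrite hphi knormZ_real gtr0_norm //.
have -> : a * N x = d / 2 by rewrite /a; field; rewrite gt_eqF.
have d2 : d / 2 < d by lra.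
move=> /(_ d2); rewrite -ler_pdivlMl // => /le_trans; apply.
rewrite le_eqVlt; apply/orP; left; apply/eqP; rewrite /a.
by field; rewrite !gt_eqF.
Qed.

Lemma continuous_linear_bounded (V W : normedModType K) (L : {linear V -> W}) :
  continuous L -> exists2 b, 0 < b & forall x, N (L x) <= b * N x.
Proof.
move=> cL; have : nbhs (0 : V) [set x | N (L x) < 1].
  have := cL 0; rewrite /continuous_at linear0 => /(cvg_knormP k)/(_ _ ltr01).
  by apply: filterS => x /=; rewrite subr0.
move=> /(nbhs_knormP k)[d d0 hd]; exists (2 * 1 / d); first by rewrite !divr_gt0 ?mulr_gt0.
apply: homogeneous_bound => // [a x|x xd]; first by rewrite linearZ knormZ_real.
by apply/ltW/hd; rewrite subr0.
Qed.

(** The supremum defining [opnorm] is meaningful only for a bounded set; continuity of [L] supplies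
    the bound. *)
Lemma opnorm_le (V W : normedModType K) (L : {linear V -> W}) (h : V) :
  continuous L -> N (L h) <= opnorm k L * N h.
Proof.
move=> cL; have [b b0 hb] := continuous_linear_bounded cL.
have le1 x : N x <= 1 -> N (L x) <= opnorm k L.
  move=> x1; apply: ub_le_sup; last by exists x.
  exists b => _ [y /= y1 <-]; apply: (le_trans (hb y)).
  by rewrite ler_piMr ?(ltW b0).
have [h0|h0] := eqVneq (N h) 0.
  by have -> := knorm0_eq0 h0; rewrite linear0 !knorm0 mulr0.
have hp : 0 < N h by rewrite lt_neqAle eq_sym h0 knorm_ge0.
rewrite -ler_pdivrMr //; have := le1 (of_real k (N h)^-1 *: h).
rewrite knormZ_real linearZ knormZ_real ger0_norm ?invr_ge0 ?knorm_ge0 //.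
by rewrite mulVf // mulrC; exact.
Qed.

End operators.

(** * Uniform bounds for the semigroup on compact time intervals *)

Section semigroup.
Context (R : realType) (K : numFieldType) (k : scalar_field R K).
Context (X : completeNormedModType K) (T : R -> {linear X -> X}).
Hypothesis hT : strongly_continuous_semigroup T.
Local Notation N := (norm k).

(** Uniform boundedness: strong continuity bounds each orbit on a time interval depending on x. The
    sets [F n] tie the bound n to the interval length 1/(n+1), so that countably many closed sets
    cover X and Baire applies. *)
Lemma semigroup_bounded_near0 : exists d M : R,
  [/\ 0 < d, 1 <= M & forall t x, 0 <= t <= d -> N (T t x) <= M * N x].
Proof.
have [Tc T0 TD Tcv] := hT.
pose F n := [set x : X | forall t, 0 <= t <= n.+1%:R^-1 -> N (T t x) <= n%:R].
have [|x|n [x [r [r0 hr]]]] := baire_category k (F := F).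
- move=> n; rewrite (_ : F n = \bigcap_(t in [set t | 0 <= t <= n.+1%:R^-1])
      [set x | N (T t x) <= n%:R]); last by [].
  apply: closed_bigI => t /andP[t0 _].
  apply: (@closed_comp _ _ (fun x => N (T t x)) [set y | y <= n%:R]).
    move=> x _; apply: (@continuous_comp _ _ _ (T t) (@norm R K k X)).
      exact: Tc.
    exact: knorm_continuous.
  exact: closed_le.
- have := Tcv x => /(cvg_knormP k)/(_ _ ltr01); rewrite near_withinE => -[d /= d0 hd].
  have hb t : 0 <= t < d -> N (T t x) <= N x + 1.
    move=> /andP[]; rewrite le_eqVlt => /predU1P[<- _|t0 td].
      by rewrite T0 lerDl.
    have := hd t; rewrite /= sub0r normrN gtr0_norm // => /(_ td t0) h.
    have := knorm_dist_le k (T t x) x; rewrite ler_norml => /andP[_]; lra.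
  (* The first entry puts the bound [N x + 1] below n, the second puts 1/(n+1) below [d]. *)
  pose n := maxn (Num.truncn (N x + 1)).+1 (Num.truncn d^-1).+1.
  exists n => t /andP[t0 tn]; apply: (le_trans (hb t _)).
    rewrite t0 (le_lt_trans tn) // invf_plt ?posrE //.
    by rewrite (lt_trans (truncnS_gt _)) // ltr_nat ltnS leq_maxr.
  by rewrite (le_trans (ltW (truncnS_gt _))) // ler_nat leq_maxl.
(* A ball inside [F n], translated to the origin, gives the bound [2 * n] for vectors of norm below
   [r]. The final 1 secures [1 <= M], so that powers of [M] increase. *)
exists n.+1%:R^-1, (2 * (2 * n%:R) / r + 1); split.
- by rewrite invr_gt0.
- by rewrite lerDr divr_ge0 ?mulr_ge0 // ltW.
move=> t y ht; apply: (@le_trans _ _ (2 * (2 * n%:R) / r * N y)); last first.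
  by rewrite ler_wpM2r ?knorm_ge0 // lerDl.
apply: (homogeneous_bound (k := k) (phi := fun y => N (T t y))) => // [a z|z zr].
  by rewrite linearZ knormZ_real.
have h1 := hr (x + z); have h2 := hr x.
have e : z = (x + z) - x by rewrite addrC addKr.
rewrite {1}e linearB (le_trans (knormB_le _ _ _)) //.
have : N (T t (x + z)) <= n%:R.
  by apply: h1 => //; rewrite /knorm_ball /= addrC addKr.
have : N (T t x) <= n%:R by apply: h2 => //; rewrite /knorm_ball /= subrr knorm0.
lra.
Qed.

(** Time is cut into steps of length [d]; by the semigroup law each step costs one factor [M]. *)
Lemma semigroup_bounded (tau : R) : exists2 M : R, 0 < M &
  forall t x, 0 <= t <= tau -> N (T t x) <= M * N x.
Proof.
have [_ T0 TD _] := hT; have [d [M [d0 M1 hM]]] := semigroup_bounded_near0.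
have M0 : 0 < M by lra.
have step n : forall t x, 0 <= t <= n%:R * d -> N (T t x) <= M ^+ n * N x.
  elim: n => [|n ih] t x /andP[t0 tn].
    have -> : t = 0 by apply/eqP; rewrite eq_le t0 andbT; lra.
    by rewrite T0 expr0 mul1r.
  have [td|td] := lerP t d.
    apply: (le_trans (hM t x _)); first by rewrite t0 td.
    by rewrite ler_wpM2r ?knorm_ge0 // exprS ler_peMr ?exprn_ege1 // ltW.
  rewrite -(subrK d t) addrC TD ?(ltW d0) ?subr_ge0 ?(ltW td) //.
  apply: (le_trans (hM d _ _)); first by rewrite (ltW d0) lexx.
  rewrite exprS -mulrA ler_wpM2l ?(ltW M0) //; apply: ih.
  by rewrite subr_ge0 (ltW td) /= lerBlDr (le_trans tn) // -natr1 mulrDl mul1r lexx.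
exists (M ^+ (Num.truncn (tau / d)).+1) => [|t x /andP[t0 tt]].
  by rewrite exprn_gt0.
apply: step; rewrite t0 (le_trans tt) // -ler_pdivrMr //.
exact/ltW/truncnS_gt.
Qed.

End semigroup.

Section nonlinearity.
Context (R : realType) (K : numFieldType) (k : scalar_field R K).
Context (X : normedModType K).
Local Notation N := (norm k).

Lemma bounded_unit_ball : bounded_set [set x : X | N x <= 1].
Proof.
exists 1; split; first exact: real1.
by move=> M M1 x /= x1; apply/ltW/(le_lt_trans _ M1); rewrite -(of_real1 k) normr_le_of_real.
Qed.

(* The Taylor bound plays the role of the mean value inequality. *)
Lemma small_lipschitz (f : X -> X) (eps : R) :
  continuously_differentiable k f -> (forall h, 'd f (0 : X) h = 0) ->
  uniform_taylor_bound k f -> 0 < eps ->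
  exists2 rho, 0 < rho &
    forall x y, N x <= rho -> N y <= rho -> N (f x - f y) <= eps * N (x - y).
Proof.
move=> [df cf] df0 tf e0.
have e2 : 0 < eps / 2 by rewrite divr_gt0.
have [d d0 hd] := cf 0 (eps / 2) e2.
have [a [g [a0 g0 hag]]] := tf _ bounded_unit_ball.
(* The threshold up to which the Taylor remainder a r^(1+g) is at most (eps / 2) r. *)
pose s := (eps / 2 / a) `^ g^-1.
have s0 : 0 < s by rewrite powR_gt0 // divr_gt0.
(* The bounds keep both points in the unit ball, the derivative at [y] below [eps / 2], and the
   distance [N (x - y) <= 2 * rho] below [s]. *)
pose rho := Num.min (1 / 2) (Num.min (d / 2) (s / 2)).
have [r1 r2 r3] : [/\ rho <= 1 / 2, rho <= d / 2 & rho <= s / 2].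
  by rewrite /rho !ge_min !lexx ?orbT.
exists rho; first by rewrite !lt_min !divr_gt0.
move=> x y xr yr.
have xy := knormB_le k x y.
have hx : N x <= 1 by lra.
have hy : N y <= 1 by lra.
have taylor := hag x y hx hy.
have hpow : a * N (x - y) `^ (1 + g) <= eps / 2 * N (x - y).
  have [z0|z0] := eqVneq (N (x - y)) 0.
    by rewrite z0 powR0 ?mulr0 // gt_eqF // addr_gt0.
  have zp : 0 < N (x - y) by rewrite lt_neqAle eq_sym z0 knorm_ge0.
  rewrite powRD; last by rewrite z0 implybT.
  rewrite powRr1 ?knorm_ge0 // mulrCA [leRHS]mulrC ler_wpM2l ?knorm_ge0 //.
  rewrite -ler_pdivlMl // mulrC.
  rewrite (_ : eps / 2 / a = s `^ g); last first.
    by rewrite /s -powRrM mulVf ?gt_eqF // powRr1 // divr_ge0 // ltW.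
  by rewrite ge0_ler_powR ?nnegrE ?knorm_ge0 ?(ltW g0) ?(ltW s0) //; lra.
have dfy : N ('d f y (x - y)) <= eps / 2 * N (x - y).
  apply: (le_trans (opnorm_le k (L := 'd f y) _ _)).
    by apply: diff_continuous; exact: df.
  rewrite ler_wpM2r ?knorm_ge0 //.
  have := hd y; rewrite subr0 (_ : 'd f y \- 'd f 0 = 'd f y); last first.
    by apply/funext => h /=; rewrite df0 subr0.
  by move=> h; apply/ltW/h; lra.
have := knormD_le k (f x - f y - 'd f y (x - y)) ('d f y (x - y)).
rewrite subrK; lra.
Qed.

End nonlinearity.

(** * Controls and mild solutions *)

Section control.
Context (R : realType) (K : numFieldType) (k : scalar_field R K).
Context (X U : completeNormedModType K).
Context (T : R -> {linear X -> X}) (B : {linear U -> X}) (tau : R).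
Let mu := @lebesgue_measure R.
Local Notation D t := (`[0%R, t]%classic : set (measurableTypeR R)).
Local Notation N := (norm k).
Hypothesis tau0 : 0 < tau.

Lemma L2_cst0 (V : normedModType K) : L2 k tau (fun=> 0 : V).
Proof.
split.
  have fu : finitely_valued (fun _ : R => tt).
    split; first exact: finite_finset.
    by move=> []; rewrite (_ : _ @^-1` _ = setT); [exact: measurableT|apply/seteqP].
  exists (fun _ _ => 0); split=> [_|r _]; last exact: cvg_cst.
  exact: (finitely_valued_comp (fun=> 0 : V) fu).
by under eq_integral do rewrite knorm0 expr0n /=; rewrite integral0 ltry.
Qed.

Lemma L2norm_cst0 (V : normedModType K) : L2norm k tau (fun=> 0 : V) = 0.
Proof.
rewrite /L2norm; under eq_integral do rewrite knorm0 expr0n /=.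
by rewrite integral0 sqrtr0.
Qed.

(** The common source of all trajectory estimates: [a] stands for values or increments of f, [w] for
    a control. Bounding [a] by a constant avoids its measurability, since only the whole integrand
    is known to be measurable. The norm of [w] over the full interval makes the bound uniform in
    t. *)
Lemma mild_estimate (M b c t : R) (a : R -> X) (w : R -> U) (y : X) :
  0 < M -> (forall t x, 0 <= t <= tau -> N (T t x) <= M * N x) ->
  0 < b -> (forall x, N (B x) <= b * N x) ->
  0 <= t <= tau -> 0 <= c -> (forall s, 0 <= s <= t -> N (a s) <= c) ->
  L2 k tau w ->
  has_bochner_integral k t (fun s => T (t - s) (a s + B (w s))) y ->
  N y <= M * tau * c + M * b * (1 + tau) * L2norm k tau w.
Proof.
move=> M0 hM b0 hb /andP[t0 tt] c0 hc Lw hy; have [mw _] := Lw; have [mg _] := hy.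
rewrite -lee_fin (le_trans (bochner_norm_le hy)) //.
have mwt := strongly_measurable_le tt mw.
have mbw t' : strongly_measurable t' w ->
    measurable_fun (D t') (fun s => (M * b)%:E * (N (w s))%:E)%E.
  by move=> m; apply: measurable_funeM; exact: measurable_normE.
have Mb0 : 0 <= M * b by rewrite mulr_ge0 // ltW.
apply: (@le_trans _ _ (\int[mu]_(s in D t) ((M * c)%:E + (M * b)%:E * (N (w s))%:E))%E).
  apply: ge0_le_integral => //.
  - by move=> s _; rewrite lee_fin knorm_ge0.
  - exact: (measurable_normE k mg).
  - by apply: emeasurable_funD => //; exact: mbw.
  move=> s; rewrite /= in_itv /= => /andP[s0 st]; rewrite -EFinM -EFinD lee_fin.
  rewrite (le_trans (hM _ _ _)) //.
    by rewrite subr_ge0 st /= lerBlDr (le_trans tt) // lerDl.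
  rewrite -mulrA -mulrDr ler_wpM2l ?(ltW M0) // (le_trans (knormD_le _ _ _)) // lerD //.
  by apply: hc; rewrite s0.
rewrite ge0_integralD //; first last.
- exact: mbw.
- by move=> s _; rewrite mule_ge0 // lee_fin // knorm_ge0.
- by move=> s _; rewrite lee_fin mulr_ge0 // ltW.
rewrite EFinD; apply: leeD.
  rewrite integral_cst //.
  apply: (@le_trans _ _ ((M * c)%:E * t%:E)%E).
    rewrite le_eqVlt; apply/orP; left; apply/eqP; congr (_ * _)%E.
    exact: lebesgue_measure_Icc.
  by rewrite -EFinM lee_fin mulrAC ler_wpM2r // ler_wpM2l // ltW.
apply: (@le_trans _ _ (\int[mu]_(s in D tau) ((M * b)%:E * (N (w s))%:E))%E).
  apply: ge0_subset_integral => //.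
  - exact: mbw.
  - by move=> s _; rewrite mule_ge0 // lee_fin // knorm_ge0.
  - by move=> s; rewrite /= !in_itv /= => /andP[-> /le_trans]; apply.
rewrite ge0_integralZl //; first last.
- by move=> s _; rewrite lee_fin knorm_ge0.
- exact: measurable_normE.
rewrite -mulrA [leRHS]EFinM; apply: lee_wpmul2l => //.
by apply: integral_norm_le_L2norm => //; exact: ltW.
Qed.

(* The Baire half of the open mapping theorem; the other half, exact solution by
   successive approximation, is absorbed in the final iteration. *)
Lemma approximate_right_inverse : exactly_controllable k T B tau ->
  exists2 C : R, 0 <= C & forall z e, 0 < e -> exists v y,
    [/\ L2 k tau v, L2norm k tau v <= C * N z,
        has_bochner_integral k tau (fun s => T (tau - s) (B (v s))) y
      & N (y - z) <= e * N z].
Proof.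
move=> hctl.
pose G v y := L2 k tau v /\
  has_bochner_integral k tau (fun s => T (tau - s) (B (v s))) y.
have GB v y v' y' : G v y -> G v' y' -> G (v \- v') (y - y').
  move=> [Lv hv] [Lv' hv']; split; first exact: L2B.
  have := bochnerB hv hv'; congr (has_bochner_integral _ _ _ _).
  by apply/funext => s; rewrite /= !linearB.
have GZ a v y : G v y -> G (fun r => of_real k a *: v r) (of_real k a *: y).
  move=> [Lv hv]; split; first exact: L2Z.
  have := bochnerZ a hv; congr (has_bochner_integral _ _ _ _).
  by apply/funext => s; rewrite /= !linearZ.
(* Exact controllability says that these sets cover X. *)
pose F n := closure [set y | exists2 v, G v y & L2norm k tau v <= n%:R].
have [|z|n [x [r [r0 hr]]]] := baire_category k (F := F).
- by move=> n; exact: closed_closure.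
- have [v Lv hv] := hctl z; exists (Num.truncn (L2norm k tau v)).+1.
  by apply: subset_closure; exists v => //; exact/ltW/truncnS_gt.
have clos y e : F n y -> 0 < e -> exists v y',
    [/\ G v y', L2norm k tau v <= n%:R & N (y' - y) < e].
  move=> Fy e0; have /Fy[y' [[v Gv nv] /= yy]] : nbhs y [set y' | N (y' - y) < e].
    by apply/(nbhs_knormP k); exists e.
  by exists v, y'.
(* Subtracting controls for the targets [x + z] and [x] moves the ball to the origin and doubles the
   bound on the control. *)
have small z e : N z < r -> 0 < e -> exists v y,
    [/\ G v y, L2norm k tau v <= 2 * n%:R & N (y - z) <= e].
  move=> zr e0; have e2 : 0 < e / 2 by rewrite divr_gt0.
  have [|v1 [y1 [G1 n1 h1]]] := clos (x + z) (e / 2) _ e2.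
    by apply: hr; rewrite /knorm_ball /= addrC addKr.
  have [|v2 [y2 [G2 n2 h2]]] := clos x (e / 2) _ e2.
    by apply: hr; rewrite /knorm_ball /= subrr knorm0.
  exists (v1 \- v2), (y1 - y2); split; first exact: GB.
    apply: (le_trans (L2norm_triangle _ _)); [by case: G1|by case: G2|lra].
  rewrite (_ : _ - z = (y1 - (x + z)) - (y2 - x)); last first.
    by rewrite opprB addrA (addrC x z) opprD addrA subrK addrAC.
  by rewrite (le_trans (knormB_le _ _ _)) //; lra.
(* The target is scaled by [a = r / (2 * N z)] to norm [r / 2] and met with control norm at most
   [2 * n]; scaling back multiplies that by [2 * N z / r]. *)
exists (4 * n%:R / r) => [|z e e0]; first by rewrite divr_ge0 ?mulr_ge0 // ltW.
have [z0|z0] := eqVneq (N z) 0.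
  have [|v [y [Gv _ _]]] := small 0 1 _ ltr01; first by rewrite knorm0.
  have [L0 h0] := GZ 0 v y Gv.
  exists (fun r => of_real k 0 *: v r), (of_real k 0 *: y); split => //.
    rewrite z0 mulr0; have [Lv _] := Gv.
    by rewrite (le_trans (L2normZ_le _ Lv)) // normr0 mul0r.
  by rewrite (knorm0_eq0 z0) of_real0 scale0r subrr knorm0 mulr0.
have zp : 0 < N z by rewrite lt_neqAle eq_sym z0 knorm_ge0.
pose a := r / (2 * N z).
have a0 : 0 < a by rewrite divr_gt0 // mulr_gt0.
have [||v [y [Gv nv hy]]] := small (of_real k a *: z) (a * (e * N z)).
- rewrite knormZ_real gtr0_norm // (_ : a * N z = r / 2); first lra.
  by rewrite /a; field; rewrite gt_eqF.
- by apply: mulr_gt0 => //; exact: mulr_gt0.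
have [L h] := GZ a^-1 v y Gv.
exists (fun r => of_real k a^-1 *: v r), (of_real k a^-1 *: y); split => //.
  have [Lv _] := Gv; rewrite (le_trans (L2normZ_le _ Lv)) // gtr0_norm ?invr_gt0 //.
  rewrite -ler_pdivlMl ?invr_gt0 // invrK (le_trans nv) //.
  rewrite le_eqVlt; apply/orP; left; apply/eqP; rewrite /a.
  by field; rewrite !gt_eqF.
have aa : of_real k a^-1 * of_real k a = 1.
  by rewrite -of_realM mulVf ?of_real1 // gt_eqF.
rewrite -[z in N (_ - z)](scale1r z) -aa -scalerA -scalerBr knormZ_real.
rewrite gtr0_norm ?invr_gt0 //.
by rewrite -ler_pdivlMl ?invr_gt0 // invrK.
Qed.

End control.

(** Breaks a circle: the estimate for a trajectory presupposes that it stays in the ball where f is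
    controlled. Continuity and the strict gain from [<=] to [<] exclude a first time at which [rho]
    is reached. *)
Lemma continuity_bootstrap (R : realType) (phi : R -> R) (tau rho : R) :
  {within `[0, tau], continuous phi} -> phi 0 < rho ->
  (forall t, 0 <= t <= tau -> (forall s, 0 <= s <= t -> phi s <= rho) -> phi t < rho) ->
  forall t, 0 <= t <= tau -> phi t <= rho.
Proof.
move=> cphi p0 boot t1 ht1; apply: contrapT => /negP; rewrite -ltNge => pt1.
pose E := [set t | 0 <= t <= tau /\ rho <= phi t].
have Et1 : E t1 by split=> //; exact: ltW.
have Elb : has_lbound E by exists 0 => t [/andP[]].
have Einf : has_inf E by split=> //; exists t1.
(* The first time at which [phi] reaches [rho]. *)
pose ts := inf E.
have ts0 : 0 <= ts by apply: lb_le_inf => [|t [/andP[]]//]; exists t1.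
have tst t : E t -> ts <= t by move=> Et; apply: ge_inf.
have tstau : ts <= tau by apply: (le_trans (tst _ Et1)); case/andP: ht1.
have tsin : 0 <= ts <= tau by rewrite ts0.
have cont e : 0 < e -> exists2 d, 0 < d &
    forall s, 0 <= s <= tau -> `|ts - s| < d -> `|phi ts - phi s| < e.
  move=> e0; have /subspace_continuousP/(_ ts) := cphi.
  rewrite /= in_itv /= => /(_ tsin) /cvgrPdist_lt/(_ _ e0).
  rewrite near_withinE => -[d /= d0 hd]; exists d => // s s01 sd.
  by apply: hd => //; rewrite /= in_itv.
have lts s : 0 <= s < ts -> phi s < rho.
  move=> /andP[s0 sts]; rewrite ltNge; apply/negP => ps.
  have : E s by split=> //; rewrite s0 (le_trans (ltW sts)).
  by move=> /tst; rewrite leNgt sts.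
have ptsge : rho <= phi ts.
  apply/ler_addgt0Pr => e e0; have [d d0 hd] := cont e e0.
  have [s Es sd] := inf_adherent d0 Einf.
  have [sin ps] := Es; have := hd s sin; rewrite distrC ger0_norm ?subr_ge0 ?tst //.
  rewrite ltrBlDr addrC => /(_ sd); rewrite ltr_norml => /andP[h _]; lra.
have ts_gt0 : 0 < ts.
  rewrite lt_neqAle ts0 andbT; apply: contraTneq ptsge => <-.
  by rewrite -ltNge.
have ptsle : phi ts <= rho.
  apply/ler_addgt0Pr => e e0; have [d d0 hd] := cont e e0.
  pose s := Num.max 0 (ts - d / 2).
  have s0 : 0 <= s by rewrite le_max lexx.
  have sts : s < ts by rewrite gt_max ts_gt0 /=; lra.
  have sd : ts - d / 2 <= s by rewrite le_max lexx orbT.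
  have sin : 0 <= s <= tau by rewrite s0 (le_trans (ltW sts)).
  have := hd s sin; rewrite ger0_norm ?subr_ge0 ?(ltW sts) //.
  have sd' : ts - s < d by lra.
  move=> /(_ sd'); rewrite ltr_norml => /andP[_ h].
  have := lts s; rewrite s0 sts => /(_ isT); lra.
have := boot ts tsin; rewrite ltNge ptsge => /(_ _)/negP; apply => //.
move=> s /andP[s0]; rewrite le_eqVlt => /predU1P[->//|sts].
by apply/ltW/lts; rewrite s0.
Qed.

(** * Size, Lipschitz dependence and linearization of mild solutions *)

Section semilinear.
Context (R : realType) (K : numFieldType) (k : scalar_field R K).
Context (X U : completeNormedModType K).
Context (T : R -> {linear X -> X}) (B : {linear U -> X}) (f : X -> X) (tau : R).
Local Notation N := (norm k).
Local Notation mild := (mild_solution k T f B tau).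
Context (M b eps rho : R).
Hypotheses (tau0 : 0 < tau) (M0 : 0 < M) (b0 : 0 < b).
Hypotheses (eps0 : 0 < eps) (rho0 : 0 < rho).
Hypothesis hM : forall t x, 0 <= t <= tau -> N (T t x) <= M * N x.
Hypothesis hb : forall u, N (B u) <= b * N u.
Hypothesis f0 : f 0 = 0.
Hypothesis hf : forall x y, N x <= rho -> N y <= rho ->
  N (f x - f y) <= eps * N (x - y).
Hypothesis small_eps : M * tau * eps <= 1 / 2.
(** The gain from the control norm to the state in [mild_estimate]. *)
Let c0 := M * b * (1 + tau).

Lemma mild_solution_init u x : mild u x -> x 0 = 0.
Proof.
move=> [_ /(_ 0)]; rewrite lexx ltW // => /(_ isT) /bochner_norm_le.
have -> : `[0%R, 0%R]%classic = [set (0 : R)] by exact: set_itv1.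
rewrite integral_set1 lee_fin => h; apply: (knorm0_eq0 (k := k)).
by apply/eqP; rewrite eq_le h knorm_ge0.
Qed.

(** While the state stays in the ball, f contributes at most [M * tau * eps * rho <= rho / 2] and
    the control at most [rho / 4]. Their sum is strictly below [rho], as the bootstrap demands. *)
Lemma mild_solution_small u x : mild u x -> L2 k tau u ->
  c0 * L2norm k tau u <= rho / 4 ->
  forall t, 0 <= t <= tau -> N (x t) <= rho.
Proof.
move=> mx Lu su; have [cx bx] := mx.
apply: (continuity_bootstrap (phi := fun t => N (x t))) => [|/=|t ht hs].
- move=> t; apply: (@continuous_comp _ _ _ (x : subspace _ -> X) (@norm R K k X)).
    exact: cx.
  exact: knorm_continuous.
- by rewrite (mild_solution_init mx) knorm0.
have := mild_estimate tau0 (c := eps * rho) M0 hM b0 hb ht _ _ Lu (bx t ht).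
rewrite mulr_ge0 ?(ltW eps0) ?(ltW rho0) // => /(_ isT) h.
apply: (le_lt_trans (h _)) => [s hs'|].
  have r0 : N (0 : X) <= rho by rewrite knorm0 ltW.
  have := hf (hs s hs') r0; rewrite f0 !subr0 => /le_trans; apply.
  by rewrite ler_wpM2l ?(ltW eps0) // hs.
rewrite -/c0 mulrA.
have : M * tau * eps * rho <= 1 / 2 * rho by rewrite ler_wpM2r // ltW.
by move: su rho0; move: (c0 * _) => L *; lra.
Qed.

(** The supremum D of the difference satisfies D <= D / 2 + c0 |u - v|, and absorbing D gives the
    factor 2, in place of Gronwall's inequality. D is finite because both trajectories stay in the
    ball. *)
Lemma mild_solution_lipschitz u v x y : mild u x -> mild v y ->
  L2 k tau u -> L2 k tau v ->
  c0 * L2norm k tau u <= rho / 4 -> c0 * L2norm k tau v <= rho / 4 ->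
  forall t, 0 <= t <= tau -> N (x t - y t) <= 2 * c0 * L2norm k tau (u \- v).
Proof.
move=> mx my Lu Lv su sv.
have xr := mild_solution_small mx Lu su; have yr := mild_solution_small my Lv sv.
have [_ bx] := mx; have [_ by_] := my.
pose E := [set N (x t - y t) | t in [set t | 0 <= t <= tau]].
have Eub : has_ubound E.
  exists (2 * rho) => _ [t /= ht <-]; rewrite (le_trans (knormB_le _ _ _)) //.
  have := xr t ht; have := yr t ht; lra.
have ED t : 0 <= t <= tau -> N (x t - y t) <= sup E.
  by move=> ht; apply: ub_le_sup => //; exists t.
have D0 : 0 <= sup E.
  by apply: (le_trans (knorm_ge0 k (x 0 - y 0))); apply: ED; rewrite lexx ltW.
have key t : 0 <= t <= tau ->
    N (x t - y t) <= 1 / 2 * sup E + c0 * L2norm k tau (u \- v).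
  move=> ht; have hB := bochnerB (bx t ht) (by_ t ht).
  have {}hB : has_bochner_integral k t
      (fun s => T (t - s) ((f (x s) - f (y s)) + B ((u \- v) s))) (x t - y t).
    move: hB; congr (has_bochner_integral _ _ _ _); apply/funext => s.
    rewrite -linearB; congr (T _ _).
    by rewrite /= [B (_ - _)]linearB opprD addrACA.
  have := mild_estimate tau0 (c := eps * sup E) M0 hM b0 hb ht _ _ (L2B Lu Lv) hB.
  rewrite mulr_ge0 ?(ltW eps0) // => /(_ isT) h.
  apply: (le_trans (h _)) => [s /andP[s0 st]|].
    have hs : 0 <= s <= tau by rewrite s0 (le_trans st) //; case/andP: ht.
    rewrite (le_trans (hf (xr s hs) (yr s hs))) // ler_wpM2l ?(ltW eps0) //.
    exact: ED.
  by rewrite -/c0 mulrA lerD2r ler_wpM2r.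
have : sup E <= 1 / 2 * sup E + c0 * L2norm k tau (u \- v).
  apply: ge_sup => [|_ [t /= ht <-]]; last exact: key.
  by exists (N (x 0 - y 0)); exists 0 => //=; rewrite lexx ltW.
by move=> hE t /ED; lra.
Qed.

(** Since the control drops by [v], adding its linear response [z] cancels every control term. What
    remains is a mild integral of [f (y s) - f (x s)] with control 0. *)
Lemma mild_solution_linearization u v x y z : mild u x -> mild (u \- v) y ->
  L2 k tau u -> L2 k tau v ->
  c0 * L2norm k tau u <= rho / 4 -> c0 * L2norm k tau (u \- v) <= rho / 4 ->
  has_bochner_integral k tau (fun s => T (tau - s) (B (v s))) z ->
  N (y tau - x tau + z) <= M * tau * eps * (2 * c0 * L2norm k tau v).
Proof.
move=> mx my Lu Lv su suv hz; have Luv := L2B Lu Lv.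
have xr := mild_solution_small mx Lu su; have yr := mild_solution_small my Luv suv.
have tin : 0 <= tau <= tau by rewrite lexx ltW.
have [_ /(_ tau tin) bx] := mx; have [_ /(_ tau tin) by_] := my.
have lip := mild_solution_lipschitz my mx Luv Lu suv su.
have Lvv : L2norm k tau ((u \- v) \- u) = L2norm k tau v.
  congr (Num.sqrt (fine _)); apply: eq_integral => s _ /=.
  by rewrite addrAC subrr sub0r knormN.
rewrite Lvv in lip.
have c00 : 0 <= c0 by rewrite /c0 !mulr_ge0 ?ltW // addr_gt0.
have hB := bochner_lin 1 (bochnerB by_ bx) hz.
have {}hB : has_bochner_integral k tau
    (fun s => T (tau - s) ((f (y s) - f (x s)) + B ((fun=> 0) s))) (y tau - x tau + z).
  move: hB; rewrite of_real1 scale1r.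
  congr (has_bochner_integral _ _ _ _); apply/funext => s.
  rewrite scale1r -linearB -linearD; congr (T _ _).
  rewrite /= [B (_ - _)]linearB linear0 addr0 opprD addrACA.
  by rewrite (addrAC (B (u s))) subrr sub0r subrK.
have := mild_estimate tau0 (c := eps * (2 * c0 * L2norm k tau v)) M0 hM b0 hb tin _ _
  (L2_cst0 k tau U) hB.
rewrite L2norm_cst0 mulr0 addr0 -(mulrA (M * tau)); apply.
  apply: mulr_ge0 (ltW eps0) _; apply: mulr_ge0 _ (L2norm_ge0 _ _ _); exact: mulr_ge0.
move=> s hs; rewrite (le_trans (hf (yr s hs) (xr s hs))) // ler_wpM2l ?(ltW eps0) //.
exact: lip.
Qed.

End semilinear.

(** * The iteration and local exact controllability *)

Lemma half_expr_small (R : realType) (e : R) : 0 < e -> exists n, (1 / 2) ^+ n < e.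
Proof.
move=> e0; have /cvgr0Pnorm_lt/(_ _ e0) : (1 / 2 : R) ^+ n @[n --> \oo] --> (0 : R).
  by apply: cvg_expr; rewrite ger0_norm; lra.
by case=> n _ hn; exists n; apply: (le_lt_trans (ler_norm _)); exact: (hn n (leqnn n)).
Qed.

Theorem theorem10 (R : realType) (K : numFieldType) (k : scalar_field R K)
    (X U : completeNormedModType K)
    (hX : hilbert_norm k X) (hU : hilbert_norm k U)
    (T : R -> {linear X -> X}) (hT : strongly_continuous_semigroup T)
    (domA : set X) (A : X -> X) (hA : infinitesimal_generator k T domA A)
    (B : {linear U -> X}) (hB : continuous B)
    (f : X -> X) (hf : continuously_differentiable k f)
    (hf0 : f 0 = 0) (hdf0 : forall h : X, 'd f (0 : X) h = 0)
    (tau : R) (htau : 0 < tau)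
    (Uad : set (R -> U)) (hUad : L2_open k tau Uad)
    (hUad0 : Uad (fun=> 0))
    (S : R -> (R -> U) -> X)
    (hS : forall u : R -> U, Uad u ->
       mild_solution k T f B tau u (fun t => S t u) /\
       (forall y : R -> X, mild_solution k T f B tau u y ->
          forall t : R, 0 <= t <= tau -> y t = S t u))
    (hB1 : uniform_taylor_bound k f)
    (hB2 : derivative_locally_lipschitz k f)
    (hlin : exactly_controllable k T B tau) :
  locally_exactly_controllable Uad S tau.
Proof.
have [M M0 hM] := semigroup_bounded k hT tau.
have [b b0 hb] := continuous_linear_bounded k hB.
have [C C0 hC] := approximate_right_inverse hlin.
pose c0 := M * b * (1 + tau).
have c0_gt0 : 0 < c0 by rewrite !mulr_gt0 // addr_gt0.
(* [kappa] is the Lipschitz loss [M * tau * eps]: at most 1/2 for stability of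
   the trajectories, and small enough to keep the linearization error below
   a quarter of the residual. *)
have [kappa [kappa0 kappa_half kappa_quarter]] : exists kappa : R,
    [/\ 0 < kappa, kappa <= 1 / 2 & kappa * (2 * c0 * C) <= 1 / 4].
  have c0C : 0 <= c0 * C by rewrite mulr_ge0 // ltW.
  move: c0C; rewrite -[2 * c0 * C]mulrA; move: (c0 * C) => p p0_.
  (* With p = c0 C, the two bounds read 1/(2 + 8p) <= 1/2 and 2p/(2 + 8p) <= 1/4. *)
  exists (2 + 8 * p)^-1; rewrite invr_gt0.
  by split; [lra|rewrite -div1r ler_pdivrMr; lra|rewrite mulrC ler_pdivrMr; lra].
pose eps := kappa / (M * tau).
have eps0 : 0 < eps by rewrite divr_gt0 // mulr_gt0.
have epsE : M * tau * eps = kappa by rewrite /eps; field; rewrite !gt_eqF.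
have small_eps : M * tau * eps <= 1 / 2 by rewrite epsE.
have [rho rho0 hlip] := small_lipschitz hf hdf0 hB1 eps0.
have [hUL hUo] := hUad; have [e1 e10 he1] := hUo _ hUad0.
(* [e1] keeps controls in [Uad]; [rho / (4 * c0)] is the smallness that the trajectory estimates
   require. *)
pose delta := Num.min e1 (rho / (4 * c0)).
have delta0 : 0 < delta by rewrite lt_min e10 divr_gt0 // mulr_gt0.
have sub0 (u : R -> U) : u \- (fun=> 0) = u by apply/funext => r /=; rewrite subr0.
pose adm (u : R -> U) := L2 k tau u /\ L2norm k tau u < delta.
have admU u : adm u -> Uad u.
  move=> [Lu nu]; apply: he1 => //; rewrite sub0.
  by rewrite (lt_le_trans nu) // ge_min lexx.
have adm_mild u : adm u -> mild_solution k T f B tau u (fun t => S t u).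
  by move=> /admU /hS [].
have adm_small u : adm u -> c0 * L2norm k tau u <= rho / 4.
  move=> [_ nu]; rewrite mulrC -ler_pdivlMr // (le_trans (ltW nu)) //.
  rewrite (_ : rho / 4 / c0 = rho / (4 * c0)); last by rewrite -mulrA -invfM.
  by rewrite /delta ge_min lexx orbT.
have lip := mild_solution_lipschitz htau M0 b0 eps0 rho0 hM hb hf0 hlip small_eps.
have lin := mild_solution_linearization htau M0 b0 eps0 rho0 hM hb hf0 hlip small_eps.
have tin : 0 <= tau <= tau by rewrite lexx ltW.
have adm0 : adm (fun=> 0) by split; [exact: L2_cst0|rewrite L2norm_cst0].
have S0 : S tau (fun=> 0) = 0.
  have [[_ bx] uniq0] := hS _ hUad0.
  apply/esym; apply: (uniq0 (fun=> 0)) => //; split=> [t|t ht]; first exact: cvg_cst.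
  (* The mild equation minus itself is the mild equation for 0. *)
  have := bochnerB (bx t ht) (bx t ht); rewrite subrr.
  congr (has_bochner_integral _ _ _ _); apply/funext => s.
  by rewrite subrr hf0 linear0 addr0 linear0.
(* The halving is conditional on [adm u'], because admissibility of the next control follows only
   from the accumulated norm bound in [inv]. The correction is subtracted, so the linear problem is
   solved for the negated residual. *)
have step z (u : R -> U) : exists u' : R -> U, adm u ->
    [/\ L2 k tau u', L2norm k tau (u' \- u) <= C * norm k (z - S tau u)
      & adm u' -> norm k (z - S tau u') <= 1 / 2 * norm k (z - S tau u)].
  have [|v [y [Lv nv hy ey]]] := hC (S tau u - z) (1 / 4); first by lra.
  rewrite knorm_distC in nv; rewrite [norm k (S tau u - z)]knorm_distC in ey.
  exists (u \- v) => admu; have [Lu nu] := admu; split; first exact: L2B.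
    rewrite (_ : L2norm k tau _ = L2norm k tau v) //.
    congr (Num.sqrt (fine _)); apply: eq_integral => s _ /=.
    by rewrite addrAC subrr sub0r knormN.
  move=> admv; have := lin _ _ _ _ _ (adm_mild _ admu) (adm_mild _ admv) Lu Lv
    (adm_small _ admu) (adm_small _ admv) hy.
  rewrite epsE /= -/c0 => h.
  have h1 : kappa * (2 * c0 * L2norm k tau v) <= 1 / 4 * norm k (z - S tau u).
    apply: (@le_trans _ _ (kappa * (2 * c0 * (C * norm k (z - S tau u))))).
      by rewrite ler_wpM2l ?(ltW kappa0) // ler_wpM2l // mulr_ge0 // ltW.
    by rewrite [2 * c0 * _]mulrA [leLHS]mulrA ler_wpM2r ?knorm_ge0.
  (* The new residual is the error of the approximate linear solution minus the linearization error,
     each at most a quarter of the old residual. *)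
  rewrite (_ : z - S tau (u \- v) =
    (y - (S tau u - z)) - (S tau (u \- v) - S tau u + y)); last first.
    by rewrite opprB [y + _]addrC opprD addrACA subrr addr0 opprB addrA subrK.
  rewrite (le_trans (knormB_le _ _ _)) //; lra.
(* The corrections sum to at most [2 * C * norm k z], which must stay below [delta]; adding 1 keeps
   the denominator positive when [C] is 0. *)
exists [set z | norm k z < delta / (2 * C + 1)]; split.
- rewrite openE => z /= hz; apply/(nbhs_knormP k).
  exists (delta / (2 * C + 1) - norm k z); first by rewrite subr_gt0.
  by move=> y hy /=; have := knormD_le k (y - z) z; rewrite subrK; lra.
- by rewrite /= knorm0 divr_gt0 //; lra.
move=> z /= hz; have [g hg] := choice (step z).
pose u_ n := iter n g (fun=> 0).
set C' := C * norm k z.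
have C'0 : 0 <= C' by rewrite mulr_ge0 // knorm_ge0.
have C'delta : 2 * C' < delta.
  have : norm k z * (2 * C + 1) < delta by rewrite -ltr_pdivlMr //; lra.
  have := knorm_ge0 k z; rewrite /C'; nra.
have p0 n : 0 < (1 / 2 : R) ^+ n by rewrite exprn_gt0.
have pS n : (1 / 2 : R) ^+ n.+1 = (1 / 2) ^+ n / 2 by rewrite exprSr mulrA mulr1.
(* The middle bound is the partial sum of the corrections C' (1/2)^i; it keeps the next iterate
   admissible. *)
have inv n : [/\ adm (u_ n), L2norm k tau (u_ n) <= 2 * C' * (1 - (1 / 2) ^+ n)
    & norm k (z - S tau (u_ n)) <= (1 / 2) ^+ n * norm k z].
  elim: n => [|n [ih1 ih2 ih3]].
    by rewrite /u_ /= L2norm_cst0 expr0 subrr mulr0 S0 subr0 mul1r.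
  have [L1 n1 r1] := hg (u_ n) ih1; rewrite -[g (u_ n)]/(u_ n.+1) in L1 n1 r1.
  have nS : L2norm k tau (u_ n.+1) <= 2 * C' * (1 - (1 / 2) ^+ n.+1).
    have := L2norm_sub_le L1 ih1.1 adm0.1; rewrite !sub0 => /le_trans; apply.
    have : C * norm k (z - S tau (u_ n)) <= (1 / 2) ^+ n * C'.
      by rewrite /C' mulrCA ler_wpM2l.
    rewrite pS; lra.
  have a1 : adm (u_ n.+1).
    split=> //; rewrite (le_lt_trans nS) // (le_lt_trans _ C'delta) //.
    by rewrite mulrBr mulr1 lerBlDr lerDl mulr_ge0 ?(ltW (p0 _)) // mulr_ge0.
  by split=> //; rewrite (le_trans (r1 a1)) // pS; lra.
have [] := @L2_complete R K k U tau u_ C' (ltW htau).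
- by move=> n; have [[]] := inv n.
- move=> n; have [a1 _ r1] := inv n; have [_ n1 _] := hg (u_ n) a1.
  by rewrite (le_trans n1) // /C' -mulrA ler_wpM2l // mulrC.
move=> u Lu hu.
have admu : adm u.
  (* The bounds on [u_ n] and [u \- u_ n] add up to [2 * C' + (1 / 2) ^+ n], so the strict
     inequality survives the limit. *)
  split=> //; have [n hn] : exists n, (1 / 2) ^+ n < delta - 2 * C'.
    by apply: half_expr_small; rewrite subr_gt0.
  have [[Ln _] nn _] := inv n.
  have := L2norm_sub_le Lu Ln adm0.1; rewrite !sub0.
  have := hu n; have := p0 n; lra.
exists u; first exact: admU.
apply/eqP; rewrite -subr_eq0; apply/eqP; apply: (knorm0_eq0 (k := k)).
apply/eqP; rewrite eq_le knorm_ge0 andbT; apply/ler_addgt0Pr => e e0; rewrite add0r.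
(* The residual at [u] is at most [(1 / 2) ^+ n * Q]: the residual at [u_ n] plus the Lipschitz
   bound on [S tau u_ n - S tau u]. *)
pose Q := norm k z + 2 * c0 * (2 * C' + 1).
have Q0 : 0 < Q.
  by rewrite /Q ltr_wpDl ?knorm_ge0 // !mulr_gt0 //; lra.
have [n hn] := half_expr_small (divr_gt0 e0 Q0).
have [a1 _ r1] := inv n.
have h1 := lip _ _ _ _ (adm_mild _ a1) (adm_mild _ admu) a1.1 admu.1
  (adm_small _ a1) (adm_small _ admu) tau tin; rewrite /= -/c0 in h1.
rewrite L2norm_distC in h1.
have h2 : 2 * c0 * L2norm k tau (u \- u_ n) <= 2 * c0 * ((2 * C' + 1) * (1 / 2) ^+ n).
  by rewrite ler_wpM2l // mulr_ge0 // ltW.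
rewrite (le_trans (knorm_triangle k (S tau (u_ n)) _ _)) //.
rewrite ltr_pdivlMr // in hn.
apply: le_trans (ltW hn); rewrite /Q mulrDr lerD //.
by rewrite (le_trans h1) // (le_trans h2) // mulrA mulrC.
Qed.
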